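(* Define, for $n\ge 0$, $$\gamma_n = \frac{t^n (q;q)_{2n} (t^2;q)_\infty}{(t^2;q)_{2n} (t,tq,tz,tz^{-1};q)_\infty} \sum_{j=0}^{2n} \frac{(t;q)_j (t;q)_{2n-j}}{(q;q)_j (q;q)_{2n-j}}z^{j-n},\qquad \delta_n = t^n \sum_{j=0}^{2n} \begin{bmatrix} 2n\\ j\end{bmatrix}_q z^{j-n}.$$ Then $(\gamma_n,\delta_n)$ is a conjugate Bailey pair relative to $(t,q)$, i.e. for every $n\ge 0$, $$\gamma_n=\sum_{l\ge n}\frac{\delta_l}{(q;q)_{l-n}(tq;q)_{l+n}}.$$
   Context: Here $q,t,z$ are complex numbers with $|q|<1$, $|t|<1$, $z\ne 0$, generic so that all denominators are nonzero and series converge. The $q$-Pochhammer symbols are $(a;q)_\infty=\prod_{k\ge0}(1-aq^k)$, $(a;q)_n=(a;q)_\infty/(aq^n;q)_\infty$, and $(a_1,\dots,a_M;q)_n=(a_1;q)_n\cdots(a_M;q)_n$ (also for $n=\infty$). The $q$-binomial coefficient is $\begin{bmatrix} M\\ N\end{bmatrix}_q=\frac{(q;q)_M}{(q;q)_N(q;q)_{M-N}}$ for $0\le N\le M$ and $0$ otherwise. *)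

(* Defs.v *)
From Stdlib Require Import Reals ZArith Arith.
From Coquelicot Require Import Coquelicot.

Open Scope C_scope.

Definition Cpowz (z : C) (k : Z) : C :=
  match k with
  | Z0 => 1
  | Zpos p => z ^ Pos.to_nat p
  | Zneg p => / (z ^ Pos.to_nat p)
  end.

(* Product of [f k] over [0 <= k < n]. *)
Fixpoint Cprod (f : nat -> C) (n : nat) : C :=
  match n with
  | O => 1
  | S m => Cprod f m * f m
  end.

(* [iota] selects the limit when it exists (it always does for [Cmod q < 1])
   and is unspecified otherwise. *)
Definition Cprod_inf (f : nat -> C) : C :=
  @iota C_CompleteNormedModule
    (fun l : C => filterlim (Cprod f) eventually (locally l)).

Definition qpoch_inf (a q : C) : C := Cprod_inf (fun k => 1 - a * q ^ k).

Definition qpoch (a q : C) (n : nat) : C :=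
  qpoch_inf a q / qpoch_inf (a * q ^ n) q.

Definition qbinom (q : C) (M N : nat) : C :=
  if (N <=? M)%nat then qpoch q q M / (qpoch q q N * qpoch q q (M - N)%nat)
  else 0.

Definition gamma (q t z : C) (n : nat) : C :=
  (t ^ n * qpoch q q (2 * n) * qpoch_inf (t ^ 2) q) /
  (qpoch (t ^ 2) q (2 * n) *
     (qpoch_inf t q * qpoch_inf (t * q) q *
        qpoch_inf (t * z) q * qpoch_inf (t * / z) q)) *
  sum_n (fun j : nat =>
    (qpoch t q j * qpoch t q (2 * n - j)%nat) /
    (qpoch q q j * qpoch q q (2 * n - j)%nat) *
    Cpowz z (Z.of_nat j - Z.of_nat n)) (2 * n)%nat.

Definition delta (q t z : C) (n : nat) : C :=
  t ^ n *
  sum_n (fun j : nat =>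
    qbinom q (2 * n) j * Cpowz z (Z.of_nat j - Z.of_nat n)) (2 * n)%nat.

Definition cbp_term (a q : C) (d : nat -> C) (n l : nat) : C :=
  d l / (qpoch q q (l - n)%nat * qpoch (a * q) q (l + n)%nat).

(* The sum over [l >= n] is indexed by [k = l - n]. *)
Definition conjugate_bailey_pair (a q : C) (g d : nat -> C) : Prop :=
  forall n : nat,
    is_series (fun k : nat => cbp_term a q d n (n + k)%nat) (g n).

(* Main.v *)
Require Import Defs.
From Stdlib Require Import Reals ZArith Arith Lra Lia.
From Coquelicot Require Import Coquelicot.

Open Scope C_scope.

(** Write [P_N] and [H_N] for the Rogers and Rogers-Szego polynomials in [z] and
    put [w = t / z].  The defining sum at [n] is [w ^ n G_(2n)], where
    [G_N = sum_k w ^ k H_(N + 2k) / ((q; q)_k (t q; q)_(N + k))] also makes sense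
    for odd [N].  By the three-term recurrence of [H] and a telescoping
    certificate, [G_N] satisfies the same three-term recurrence in [N] as
    [R_N = (q; q)_N / (t ^ 2; q)_N P_N], whence [G_N = G_0 R_N].  For [|z| < 1]
    both sides converge as [N -> oo], and the q-binomial theorem evaluates the
    limits, which determines [G_0].  The case [|z| = 1] follows by continuity in
    [z], and [|z| > 1] by the symmetry [z -> 1 / z].  Convergence of the series
    forces [|t z| < 1] and [|t / z| < 1], because [H_N] has a nonzero limit when
    [|z| < 1]. *)

(** [G_0] is a series in the [H_(2k)] with no visible product form, whereas letting [N -> oo]
    replaces every [H_(N + 2k)] by the single constant [1 / (z; q)_oo] and leaves Euler's series in
    [w]. The recurrence carries this information back to [N = 0]. It links consecutive indices, so
    odd [N] enter although only [G_(2n)] is wanted. One initial value suffices because the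
    coefficient [1 - q ^ N] of the earlier term vanishes at [N = 0], and dividing by the limit of
    [R_N] is legitimate because that limit is a quotient of nonzero infinite products. At [z = 1]
    the values [H_N] grow linearly, so two kinds of majorant are needed: one uniform in [N] for
    fixed [|z| < 1], used for [N -> oo], and one linear in [N] but uniform over [|z| <= 1], absorbed
    by the geometric factor [w ^ k] and used for convergence and for the approach to the unit
    circle. *)

(** * Limits and series of complex numbers *)

Definition Ccv (u : nat -> C) (l : C) : Prop :=
  forall eps : R, (0 < eps)%R ->
    exists N : nat, forall n : nat, (N <= n)%nat -> (Cmod (u n - l) < eps)%R.

(** Summation is over [k < n], while [sum_n] includes the index [n]. The empty sum suits telescoping
    and tail estimates, at the price of an [S] in the bridges [Csum_sum_n] and [Cser_is_series]. *)
Fixpoint Csum (f : nat -> C) (n : nat) : C :=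
  match n with
  | O => 0
  | S m => Csum f m + f m
  end.

Definition Cser (f : nat -> C) (l : C) : Prop := Ccv (Csum f) l.

Lemma Cmod_minus_sym (a b : C) : Cmod (a - b) = Cmod (b - a).
Proof. rewrite <- Cmod_opp. f_equal. ring. Qed.

Lemma Cmod_triangle_sub (a b : C) : (Cmod (a - b) <= Cmod a + Cmod b)%R.
Proof. rewrite <- (Cmod_opp b). apply Cmod_triangle. Qed.

Lemma Cmod_triangle_rev (a b : C) : (Cmod a - Cmod b <= Cmod (a - b))%R.
Proof.
  pose proof (Cmod_triangle (a - b) b) as H.
  replace (a - b + b) with a in H by ring. lra.
Qed.

(** Bridge to the filters in which [Cprod_inf] and [is_series] are stated; all estimates use the
    epsilon form in [Cmod]. *)
Lemma Ccv_filterlim (u : nat -> C) (l : C) :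
  Ccv u l <-> filterlim u eventually (@locally C_UniformSpace l).
Proof.
  split.
  - intros H. apply (@filterlim_locally_ball_norm C_AbsRing nat C_NormedModule).
    { apply eventually_filter. }
    intros eps. destruct (H eps (cond_pos eps)) as [N HN].
    exists N. exact HN.
  - intros H eps Heps.
    pose proof (proj1 (@filterlim_locally_ball_norm C_AbsRing nat C_NormedModule
      eventually _ u l) H (mkposreal eps Heps)) as [N HN].
    exists N. exact HN.
Qed.

Lemma Ccv_unique (u : nat -> C) (l m : C) : Ccv u l -> Ccv u m -> l = m.
Proof.
  intros Hl Hm. apply Ccv_filterlim in Hl. apply Ccv_filterlim in Hm.
  exact (@filterlim_locally_unique nat C_AbsRing C_NormedModule eventually _
    u l m Hl Hm).
Qed.

Lemma Ccv_ext (u v : nat -> C) (l : C) :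
  (forall n, u n = v n) -> Ccv u l -> Ccv v l.
Proof.
  intros E H eps Heps. destruct (H eps Heps) as [N HN].
  exists N. intros n Hn. rewrite <- E. auto.
Qed.

Lemma Ccv_const (c : C) : Ccv (fun _ => c) c.
Proof.
  intros eps Heps. exists O. intros n _.
  replace (c - c) with (RtoC 0) by ring. rewrite Cmod_0. exact Heps.
Qed.

Lemma Ccv_subseq (u : nat -> C) (l : C) (p : nat -> nat) :
  (forall n, n <= p n)%nat -> Ccv u l -> Ccv (fun n => u (p n)) l.
Proof.
  intros Hp H eps Heps. destruct (H eps Heps) as [N HN].
  exists N. intros n Hn. apply HN. specialize (Hp n). lia.
Qed.

Lemma Ccv_plus (u v : nat -> C) (l m : C) :
  Ccv u l -> Ccv v m -> Ccv (fun n => u n + v n) (l + m).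
Proof.
  intros Hu Hv eps Heps.
  destruct (Hu (eps / 2)%R ltac:(lra)) as [N1 H1].
  destruct (Hv (eps / 2)%R ltac:(lra)) as [N2 H2].
  exists (N1 + N2)%nat. intros n Hn.
  specialize (H1 n ltac:(lia)). specialize (H2 n ltac:(lia)).
  replace (u n + v n - (l + m)) with ((u n - l) + (v n - m)) by ring.
  pose proof (Cmod_triangle (u n - l) (v n - m)). lra.
Qed.

Lemma Ccv_bounded (u : nat -> C) (l : C) : Ccv u l ->
  exists N, forall n, (N <= n)%nat -> (Cmod (u n) <= Cmod l + 1)%R.
Proof.
  intros H. destruct (H 1%R ltac:(lra)) as [N HN].
  exists N. intros n Hn. specialize (HN n Hn).
  pose proof (Cmod_triangle_rev (u n) l). lra.
Qed.

Lemma Ccv_mult (u v : nat -> C) (l m : C) :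
  Ccv u l -> Ccv v m -> Ccv (fun n => u n * v n) (l * m).
Proof.
  intros Hu Hv eps Heps.
  destruct (Ccv_bounded v m Hv) as [N0 H0].
  pose proof (Cmod_ge_0 l) as Hl. pose proof (Cmod_ge_0 m) as Hm.
  set (B := (Cmod l + Cmod m + 1)%R).
  assert (HB : (0 < B)%R) by (unfold B; lra).
  assert (He : (0 < eps / (2 * B))%R).
  { apply Rdiv_lt_0_compat; lra. }
  destruct (Hu _ He) as [N1 H1]. destruct (Hv _ He) as [N2 H2].
  exists (N0 + N1 + N2)%nat. intros n Hn.
  specialize (H0 n ltac:(lia)). specialize (H1 n ltac:(lia)).
  specialize (H2 n ltac:(lia)).
  replace (u n * v n - l * m) with ((u n - l) * v n + l * (v n - m)) by ring.
  eapply Rle_lt_trans; [apply Cmod_triangle|]. rewrite !Cmod_mult.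
  assert (E : (eps / (2 * B) * B = eps / 2)%R) by (field; lra).
  pose proof (Cmod_ge_0 (u n - l)). pose proof (Cmod_ge_0 (v n - m)).
  pose proof (Cmod_ge_0 (v n)).
  assert (Cmod (u n - l) * Cmod (v n) <= eps / (2 * B) * Cmod (v n))%R
    by (apply Rmult_le_compat_r; lra).
  assert (eps / (2 * B) * Cmod (v n) <= eps / (2 * B) * (Cmod m + 1))%R
    by (apply Rmult_le_compat_l; lra).
  assert (Cmod l * Cmod (v n - m) <= Cmod l * (eps / (2 * B)))%R
    by (apply Rmult_le_compat_l; lra).
  unfold B in *. nra.
Qed.

Lemma Ccv_scal (c : C) (u : nat -> C) (l : C) :
  Ccv u l -> Ccv (fun n => c * u n) (c * l).
Proof. intros H. apply Ccv_mult; [apply Ccv_const | exact H]. Qed.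

Lemma Ccv_minus (u v : nat -> C) (l m : C) :
  Ccv u l -> Ccv v m -> Ccv (fun n => u n - v n) (l - m).
Proof.
  intros Hu Hv. replace (l - m) with (l + (- (1)) * m) by ring.
  apply Ccv_ext with (fun n => u n + (- (1)) * v n).
  - intros n. ring.
  - apply Ccv_plus; [exact Hu|]. apply Ccv_scal. exact Hv.
Qed.

Lemma Ccv_inv (u : nat -> C) (l : C) :
  l <> 0 -> Ccv u l -> Ccv (fun n => / u n) (/ l).
Proof.
  intros Hl Hu eps Heps.
  pose proof (proj1 (Cmod_gt_0 l) Hl) as Hp.
  assert (He : (0 < eps * (Cmod l * Cmod l) / 2)%R).
  { apply Rdiv_lt_0_compat; [|lra]. apply Rmult_lt_0_compat; [lra|].
    apply Rmult_lt_0_compat; lra. }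
  destruct (Hu _ He) as [N1 H1].
  destruct (Hu (Cmod l / 2)%R ltac:(lra)) as [N2 H2].
  exists (N1 + N2)%nat. intros n Hn.
  specialize (H1 n ltac:(lia)). specialize (H2 n ltac:(lia)).
  pose proof (Cmod_triangle_rev l (u n)) as H3.
  rewrite Cmod_minus_sym in H3.
  assert (Hun : (Cmod l / 2 < Cmod (u n))%R) by lra.
  assert (Hn0 : u n <> 0) by (apply Cmod_gt_0; lra).
  replace (/ u n - / l) with (- (u n - l) / (u n * l))
    by (field; split; assumption).
  rewrite Cmod_div by (apply Cmult_neq_0; assumption).
  rewrite Cmod_opp, Cmod_mult.
  apply Rmult_lt_reg_r with (Cmod (u n) * Cmod l)%R.
  { apply Rmult_lt_0_compat; lra. }
  unfold Rdiv. rewrite Rmult_assoc, Rinv_l.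
  2: { apply Rgt_not_eq. apply Rmult_lt_0_compat; lra. }
  rewrite Rmult_1_r.
  eapply Rlt_trans; [exact H1|].
  replace (eps * (Cmod l * Cmod l) / 2)%R with (eps * (Cmod l / 2 * Cmod l))%R
    by field.
  apply Rmult_lt_compat_l; [lra|]. apply Rmult_lt_compat_r; lra.
Qed.

Lemma Ccv_pow (u : nat -> C) (l : C) (k : nat) :
  Ccv u l -> Ccv (fun n => u n ^ k) (l ^ k).
Proof.
  intros H. induction k as [|k IH].
  - exact (Ccv_const 1).
  - apply (Ccv_mult u (fun n => u n ^ k)); assumption.
Qed.

Lemma Ccv_Cmod_le (u : nat -> C) (l : C) (B : R) :
  Ccv u l -> (exists N, forall n, (N <= n)%nat -> (Cmod (u n) <= B)%R) ->
  (Cmod l <= B)%R.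
Proof.
  intros H [N HN]. apply Rnot_lt_le. intros Hlt.
  destruct (H (Cmod l - B)%R ltac:(lra)) as [N1 H1].
  specialize (HN (N + N1)%nat ltac:(lia)).
  specialize (H1 (N + N1)%nat ltac:(lia)).
  rewrite Cmod_minus_sym in H1.
  pose proof (Cmod_triangle_rev l (u (N + N1)%nat)). lra.
Qed.

Lemma geometric_small (B r eps : R) :
  (0 <= B)%R -> (0 <= r < 1)%R -> (0 < eps)%R ->
  exists N, forall n, (N <= n)%nat -> (B * r ^ n < eps)%R.
Proof.
  intros HB Hr Heps.
  (* Dividing by [B + 1] instead of [B] covers [B = 0]. *)
  destruct (pow_lt_1_zero r ltac:(rewrite Rabs_pos_eq; lra)
    (eps / (B + 1))%R ltac:(apply Rdiv_lt_0_compat; lra)) as [N HN].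
  exists N. intros n Hn. specialize (HN n Hn).
  rewrite Rabs_pos_eq in HN by (apply pow_le; lra).
  apply Rmult_lt_compat_l with (r := (B + 1)%R) in HN; [|lra].
  replace ((B + 1) * (eps / (B + 1)))%R with eps in HN by (field; lra).
  pose proof (pow_le r n ltac:(lra)). nra.
Qed.

Lemma Ccv_0_geometric (u : nat -> C) (B r : R) :
  (0 <= r < 1)%R -> (forall n, (Cmod (u n) <= B * r ^ n)%R) -> Ccv u 0.
Proof.
  intros Hr Hu eps Heps.
  assert (HB : (0 <= B)%R).
  { specialize (Hu O). simpl in Hu. pose proof (Cmod_ge_0 (u O)). lra. }
  destruct (geometric_small B r eps HB Hr Heps) as [N HN].
  exists N. intros n Hn. specialize (HN n Hn). specialize (Hu n).
  replace (u n - 0) with (u n) by ring. lra.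
Qed.

Lemma Csum_ext (f g : nat -> C) (n : nat) :
  (forall k, (k < n)%nat -> f k = g k) -> Csum f n = Csum g n.
Proof.
  induction n as [|n IH]; intros H; simpl; [reflexivity|].
  rewrite IH by (intros; apply H; lia). rewrite H by lia. reflexivity.
Qed.

Lemma Csum_scal (c : C) (f : nat -> C) (n : nat) :
  Csum (fun k => c * f k) n = c * Csum f n.
Proof. induction n as [|n IH]; simpl; [|rewrite IH]; ring. Qed.

Lemma Csum_plus (f g : nat -> C) (n : nat) :
  Csum (fun k => f k + g k) n = Csum f n + Csum g n.
Proof. induction n as [|n IH]; simpl; [|rewrite IH]; ring. Qed.

Lemma Csum_shift (f : nat -> C) (n : nat) :
  Csum f (S n) = f O + Csum (fun k => f (S k)) n.
Proof.
  induction n as [|n IH]; [simpl; ring|].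
  change (Csum f (S (S n))) with (Csum f (S n) + f (S n)).
  rewrite IH. simpl. ring.
Qed.

Lemma Csum_rev (f : nat -> C) (n : nat) :
  Csum f (S n) = Csum (fun k => f (n - k)%nat) (S n).
Proof.
  revert f. induction n as [|n IH]; intros f; [reflexivity|].
  rewrite (Csum_shift (fun k => f (S n - k)%nat)).
  change (Csum f (S (S n))) with (Csum f (S n) + f (S n)).
  rewrite IH, Nat.sub_0_r, Cplus_comm. reflexivity.
Qed.

Lemma Csum_sum_n (f : nat -> C) (n : nat) :
  @sum_n C_AbelianMonoid f n = Csum f (S n).
Proof.
  induction n as [|n IH].
  - rewrite sum_O. simpl. ring.
  - rewrite sum_Sn, IH. reflexivity.
Qed.

Lemma Csum_tail (f : nat -> C) (B r : R) (K n : nat) :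
  (0 <= r < 1)%R -> (forall k, (Cmod (f k) <= B * r ^ k)%R) -> (K <= n)%nat ->
  (Cmod (Csum f n - Csum f K) <= B / (1 - r) * r ^ K)%R.
Proof.
  intros Hr Hf HKn.
  assert (HB : (0 <= B)%R).
  { specialize (Hf O). simpl in Hf. pose proof (Cmod_ge_0 (f O)). lra. }
  (* Keeping the subtracted [r ^ n] gives the exact geometric partial sum, so that the induction
     closes. *)
  enough (H : (Cmod (Csum f n - Csum f K) <= B / (1 - r) * (r ^ K - r ^ n))%R).
  { pose proof (pow_le r n ltac:(lra)).
    assert (0 <= B / (1 - r))%R.
    { apply Rmult_le_pos; [lra|]. left. apply Rinv_0_lt_compat. lra. }
    nra. }
  induction HKn as [|n HKn IH].
  - replace (Csum f K - Csum f K) with (RtoC 0) by ring. rewrite Cmod_0. lra.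
  - simpl Csum.
    replace (Csum f n + f n - Csum f K) with (Csum f n - Csum f K + f n) by ring.
    eapply Rle_trans; [apply Cmod_triangle|].
    specialize (Hf n).
    replace (B / (1 - r) * (r ^ K - r ^ S n))%R
      with (B / (1 - r) * (r ^ K - r ^ n) + B * r ^ n)%R by (simpl; field; lra).
    lra.
Qed.

Lemma Cser_is_series (f : nat -> C) (l : C) :
  Cser f l <-> @is_series C_AbsRing C_NormedModule f l.
Proof.
  assert (E : forall n, @sum_n C_NormedModule f n = Csum f (S n))
    by exact (Csum_sum_n f).
  unfold is_series. rewrite <- (Ccv_filterlim (@sum_n C_NormedModule f) l).
  split; intros H.
  - apply (Ccv_ext (fun n => Csum f (S n))); [intros n; symmetry; apply E|].
    apply (Ccv_subseq (Csum f) l S); [intros; lia | exact H].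
  - intros eps Heps. destruct (H eps Heps) as [N HN].
    exists (S N). intros [|n] Hn; [lia|]. rewrite <- E. apply HN. lia.
Qed.

Lemma Cser_ex (f : nat -> C) (B r : R) :
  (0 <= r < 1)%R -> (forall k, (Cmod (f k) <= B * r ^ k)%R) ->
  exists l, Cser f l.
Proof.
  intros Hr Hf.
  assert (H : @ex_series C_AbsRing C_CompleteNormedModule f).
  { apply ex_series_le with (fun k => B * r ^ k)%R.
    - exact Hf.
    - apply (@ex_series_scal R_AbsRing R_NormedModule B (fun k => (r ^ k)%R)).
      apply ex_series_geom.
      rewrite Rabs_pos_eq; lra. }
  destruct H as [l Hl]. exists l. apply Cser_is_series. exact Hl.
Qed.

Lemma Cser_ext (f g : nat -> C) (l : C) :
  (forall k, f k = g k) -> Cser f l -> Cser g l.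
Proof.
  intros E. apply Ccv_ext. intros n. apply Csum_ext. intros k _. apply E.
Qed.

Lemma Cser_scal (c : C) (f : nat -> C) (l : C) :
  Cser f l -> Cser (fun k => c * f k) (c * l).
Proof.
  intros H. apply (Ccv_ext (fun n => c * Csum f n)).
  - intros n. symmetry. apply Csum_scal.
  - apply Ccv_scal. exact H.
Qed.

Lemma Cser_plus (f g : nat -> C) (l m : C) :
  Cser f l -> Cser g m -> Cser (fun k => f k + g k) (l + m).
Proof.
  intros Hf Hg. apply (Ccv_ext (fun n => Csum f n + Csum g n)).
  - intros n. symmetry. apply Csum_plus.
  - apply Ccv_plus; assumption.
Qed.

Lemma Cser_minus (f g : nat -> C) (l m : C) :
  Cser f l -> Cser g m -> Cser (fun k => f k - g k) (l - m).
Proof.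
  intros Hf Hg. replace (l - m) with (l + (- (1)) * m) by ring.
  apply (Cser_ext (fun k => f k + (- (1)) * g k)); [intros; ring|].
  apply Cser_plus; [|apply Cser_scal]; assumption.
Qed.

Lemma Cser_shift (f : nat -> C) (l : C) :
  Cser (fun k => f (S k)) l -> Cser f (f O + l).
Proof.
  intros H eps Heps.
  destruct (Ccv_plus _ _ _ _ (Ccv_const (f O)) H eps Heps) as [N HN].
  exists (S N). intros [|n] Hn; [lia|]. rewrite Csum_shift. apply HN. lia.
Qed.

Lemma Cser_telescope (b : nat -> C) :
  Ccv b 0 -> Cser (fun k => b k - b (S k)) (b O).
Proof.
  intros H. replace (b O) with (b O - 0) by ring.
  apply (Ccv_ext (fun n => b O - b n)).
  - induction n as [|n IH]; simpl; [|rewrite <- IH]; ring.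
  - apply Ccv_minus; [apply Ccv_const | exact H].
Qed.

Lemma Cser_terms_0 (f : nat -> C) (l : C) : Cser f l -> Ccv f 0.
Proof.
  intros H. replace (RtoC 0) with (l - l) by ring.
  apply (Ccv_ext (fun n => Csum f (S n) - Csum f n)).
  - intros n. simpl. ring.
  - apply Ccv_minus; [|exact H].
    apply (Ccv_subseq (Csum f) l S); [intros; lia | exact H].
Qed.

Lemma Cser_finite (f : nat -> C) (n : nat) :
  (forall k, (n <= k)%nat -> f k = 0) -> Cser f (Csum f n).
Proof.
  intros Hf eps Heps. exists n. intros m Hm.
  replace (Csum f m - Csum f n) with (RtoC 0); [rewrite Cmod_0; exact Heps|].
  induction Hm as [|m Hm IH]; [ring|].
  simpl. rewrite Hf by lia.
  replace (Csum f m + 0 - Csum f n) with (Csum f m - Csum f n) by ring. exact IH.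
Qed.

Lemma Ccv_Csum (f : nat -> nat -> C) (g : nat -> C) (K : nat) :
  (forall k, Ccv (fun m => f m k) (g k)) ->
  Ccv (fun m => Csum (f m) K) (Csum g K).
Proof.
  intros H. induction K as [|K IH]; simpl.
  - apply Ccv_const.
  - apply (Ccv_plus (fun m => Csum (f m) K) (fun m => f m K)); auto.
Qed.

(** Dominated convergence for series: the common majorant makes all tails beyond some [K] smaller
    than [eps / 3], and the first [K] terms converge as a finite sum. Every exchange of a limit with
    an infinite sum goes through this lemma. *)
Lemma tannery (f : nat -> nat -> C) (g : nat -> C) (s : nat -> C) (L : C)
    (B r : R) :
  (0 <= r < 1)%R -> (forall m k, (Cmod (f m k) <= B * r ^ k)%R) ->
  (forall k, Ccv (fun m => f m k) (g k)) ->
  (forall m, Cser (f m) (s m)) -> Cser g L -> Ccv s L.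
Proof.
  intros Hr Hf Hfg Hs HL eps Heps.
  assert (HB : (0 <= B)%R).
  { specialize (Hf O O). simpl in Hf. pose proof (Cmod_ge_0 (f O O)). lra. }
  assert (Hg : forall k, (Cmod (g k) <= B * r ^ k)%R).
  { intros k. apply (Ccv_Cmod_le (fun m => f m k)); [apply Hfg|].
    exists O. intros n _. apply Hf. }
  assert (T : forall h l K, (forall k, (Cmod (h k) <= B * r ^ k)%R) ->
    Cser h l -> (Cmod (l - Csum h K) <= B / (1 - r) * r ^ K)%R).
  { intros h l K Hh Hl. apply (Ccv_Cmod_le (fun n => Csum h n - Csum h K)).
    - apply Ccv_minus; [exact Hl | apply Ccv_const].
    - exists K. intros n Hn. apply Csum_tail; assumption. }
  assert (HB' : (0 <= B / (1 - r))%R).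
  { apply Rmult_le_pos; [lra|]. left. apply Rinv_0_lt_compat. lra. }
  destruct (geometric_small _ r (eps / 3)%R HB' Hr ltac:(lra)) as [K HK].
  specialize (HK K (le_n K)).
  destruct (Ccv_Csum f g K Hfg (eps / 3)%R ltac:(lra)) as [N HN].
  exists N. intros n Hn. specialize (HN n Hn).
  pose proof (T (f n) (s n) K (Hf n) (Hs n)) as T1.
  pose proof (T g L K Hg HL) as T2. rewrite Cmod_minus_sym in T2.
  replace (s n - L) with ((s n - Csum (f n) K)
    + ((Csum (f n) K - Csum g K) + (Csum g K - L))) by ring.
  pose proof (Cmod_triangle (s n - Csum (f n) K)
    ((Csum (f n) K - Csum g K) + (Csum g K - L))).
  pose proof (Cmod_triangle (Csum (f n) K - Csum g K) (Csum g K - L)). lra.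
Qed.

(** * q-Pochhammer symbols and the q-binomial theorem *)

(** A total function, so that sums can be named before convergence is known; its value is meaningful
    only through [CSeries_correct]. *)
Definition CSeries (f : nat -> C) : C :=
  @iota C_CompleteNormedModule (fun l : C => Cser f l).

Lemma CSeries_correct (f : nat -> C) :
  (exists l, Cser f l) -> Cser f (CSeries f).
Proof.
  intros [l Hl].
  apply (@iota_correct C_AbsRing C_CompleteNormedModule (fun l : C => Cser f l)).
  exists l. split; [exact Hl|]. intros m Hm. exact (Ccv_unique _ _ _ Hl Hm).
Qed.

(** [qpoch] is a quotient of two limits, whereas recurrences and estimates need the finite product;
    [qpoch_fpoch] identifies the two for [|q| < 1] and [|a| < 1]. *)
Definition fpoch (a q : C) (n : nat) : C := Cprod (fun k => 1 - a * q ^ k) n.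

Lemma fpoch_S (a q : C) (n : nat) :
  fpoch a q (S n) = fpoch a q n * (1 - a * q ^ n).
Proof. reflexivity. Qed.

Lemma fpoch_add (a q : C) (m n : nat) :
  fpoch a q (m + n) = fpoch a q m * fpoch (a * q ^ m) q n.
Proof.
  induction n as [|n IH].
  - rewrite Nat.add_0_r. unfold fpoch at 3. simpl. ring.
  - rewrite Nat.add_succ_r, !fpoch_S, IH, Cpow_add_r. ring.
Qed.

Lemma Cmod_mul_pow_le (a q : C) (n : nat) :
  (Cmod q < 1)%R -> (Cmod (a * q ^ n) <= Cmod a)%R.
Proof.
  intros Hq. rewrite Cmod_mult, Cmod_pow.
  pose proof (Cmod_ge_0 a). pose proof (Cmod_ge_0 q).
  assert (Cmod q ^ n <= 1 ^ n)%R by (apply pow_incr; lra).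
  rewrite pow1 in *. nra.
Qed.

(** Applying [1 + x <= exp x] to each factor puts a geometric sum into the exponent; its exact
    partial sum is kept until the induction is over. *)
Lemma fpoch_bounded (a q : C) : (Cmod q < 1)%R ->
  exists B : R, forall n, (Cmod (fpoch a q n) <= B)%R.
Proof.
  intros Hq. pose proof (Cmod_ge_0 a) as Ha. pose proof (Cmod_ge_0 q) as Hq0.
  exists (exp (Cmod a / (1 - Cmod q))). intros n.
  apply Rle_trans with (exp (Cmod a * (1 - Cmod q ^ n) / (1 - Cmod q))).
  - induction n as [|n IH].
    + unfold fpoch. simpl. rewrite Cmod_1.
      replace (Cmod a * (1 - 1) / (1 - Cmod q))%R with 0%R by (field; lra).
      rewrite exp_0. lra.
    + rewrite fpoch_S, Cmod_mult.
      replace (Cmod a * (1 - Cmod q ^ S n) / (1 - Cmod q))%R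
        with (Cmod a * (1 - Cmod q ^ n) / (1 - Cmod q) + Cmod a * Cmod q ^ n)%R
        by (simpl; field; lra).
      rewrite exp_plus.
      apply Rmult_le_compat; try apply Cmod_ge_0; [exact IH|].
      eapply Rle_trans; [apply Cmod_triangle_sub|].
      rewrite Cmod_1, Cmod_mult, Cmod_pow. apply exp_ineq1_le.
  - assert (Hle : (Cmod a * (1 - Cmod q ^ n) / (1 - Cmod q)
        <= Cmod a / (1 - Cmod q))%R).
    { apply Rmult_le_compat_r; [left; apply Rinv_0_lt_compat; lra|].
      pose proof (pow_le (Cmod q) n Hq0). nra. }
    destruct (Rle_lt_or_eq_dec _ _ Hle) as [H|H].
    + left. apply exp_increasing. exact H.
    + rewrite H. lra.
Qed.

Lemma fpoch_bounded_below (a q : C) : (Cmod q < 1)%R -> (Cmod a < 1)%R ->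
  exists c : R, (0 < c)%R /\ forall n, (c <= Cmod (fpoch a q n))%R.
Proof.
  intros Hq Ha1. pose proof (Cmod_ge_0 a) as Ha. pose proof (Cmod_ge_0 q) as Hq0.
  (* For [0 <= x <= |a|] one has [1 <= (1 - x) (1 + x / (1 - |a|))], hence
     [1 - x >= exp (- x / (1 - |a|))]. With [x = |a| |q| ^ k], the exponents add up to at most
     [|a| d] in absolute value. *)
  set (d := (/ ((1 - Cmod a) * (1 - Cmod q)))%R).
  assert (Hd : (0 < d)%R).
  { apply Rinv_0_lt_compat. apply Rmult_lt_0_compat; lra. }
  exists (/ exp (Cmod a * d))%R. split; [apply Rinv_0_lt_compat, exp_pos|].
  assert (H : forall n,
    (1 <= Cmod (fpoch a q n) * exp (Cmod a * (1 - Cmod q ^ n) * d))%R).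
  { induction n as [|n IH].
    - unfold fpoch. simpl. rewrite Cmod_1.
      replace (Cmod a * (1 - 1) * d)%R with 0%R by ring.
      rewrite exp_0. lra.
    - rewrite fpoch_S, Cmod_mult.
      set (x := (Cmod a * Cmod q ^ n)%R).
      assert (Hx : (0 <= x <= Cmod a)%R).
      { split; [apply Rmult_le_pos; [exact Ha | apply pow_le; exact Hq0]|].
        unfold x. rewrite <- Cmod_pow, <- Cmod_mult. apply Cmod_mul_pow_le, Hq. }
      replace (Cmod a * (1 - Cmod q ^ S n) * d)%R
        with (Cmod a * (1 - Cmod q ^ n) * d + x / (1 - Cmod a))%R
        by (unfold d, x; simpl; field; lra).
      rewrite exp_plus.
      assert (H1 : (1 - x <= Cmod (1 - a * q ^ n))%R).
      { pose proof (Cmod_triangle_rev 1 (a * q ^ n)) as H2.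
        rewrite Cmod_1, Cmod_mult, Cmod_pow in H2. exact H2. }
      assert (H2 : (1 + x / (1 - Cmod a) <= exp (x / (1 - Cmod a)))%R)
        by apply exp_ineq1_le.
      assert (H3 : (1 <= (1 - x) * (1 + x / (1 - Cmod a)))%R).
      { replace ((1 - x) * (1 + x / (1 - Cmod a)))%R
          with (1 + x * (Cmod a - x) * / (1 - Cmod a))%R by (field; lra).
        assert (0 <= x * (Cmod a - x) * / (1 - Cmod a))%R; [|lra].
        apply Rmult_le_pos; [apply Rmult_le_pos; lra|].
        left. apply Rinv_0_lt_compat. lra. }
      assert (H4 : (0 <= x / (1 - Cmod a))%R).
      { apply Rmult_le_pos; [lra|]. left. apply Rinv_0_lt_compat. lra. }
      assert (H5 : (1 <= Cmod (1 - a * q ^ n) * exp (x / (1 - Cmod a)))%R).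
      { eapply Rle_trans; [exact H3|]. apply Rmult_le_compat; lra. }
      match goal with |- (1 <= ?A * ?B * (?E1 * ?E2))%R =>
        replace (A * B * (E1 * E2))%R with ((A * E1) * (B * E2))%R by ring end.
      nra. }
  intros n. specialize (H n).
  assert (He : (exp (Cmod a * (1 - Cmod q ^ n) * d) <= exp (Cmod a * d))%R).
  { assert (Hle : (Cmod a * (1 - Cmod q ^ n) * d <= Cmod a * d)%R).
    { apply Rmult_le_compat_r; [lra|].
      pose proof (pow_le (Cmod q) n Hq0). nra. }
    destruct (Rle_lt_or_eq_dec _ _ Hle) as [H'|H'].
    - left. apply exp_increasing. exact H'.
    - rewrite H'. lra. }
  pose proof (exp_pos (Cmod a * d)) as Hp.
  apply Rmult_le_reg_r with (exp (Cmod a * d)); [exact Hp|].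
  rewrite Rinv_l by lra.
  pose proof (Cmod_ge_0 (fpoch a q n)). nra.
Qed.

Lemma fpoch_neq_0 (a q : C) (n : nat) :
  (Cmod q < 1)%R -> (Cmod a < 1)%R -> fpoch a q n <> 0.
Proof.
  intros Hq Ha. destruct (fpoch_bounded_below a q Hq Ha) as [c [Hc H]].
  apply Cmod_gt_0. specialize (H n). lra.
Qed.

Lemma one_minus_neq_0 (a : C) : (Cmod a < 1)%R -> 1 - a <> 0.
Proof.
  intros Ha H. assert (E : a = 1).
  { replace a with (1 - (1 - a)) by ring. rewrite H. ring. }
  rewrite E, Cmod_1 in Ha. lra.
Qed.

Lemma one_minus_mul_pow_neq_0 (a q : C) (n : nat) :
  (Cmod q < 1)%R -> (Cmod a < 1)%R -> 1 - a * q ^ n <> 0.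
Proof.
  intros Hq Ha. apply one_minus_neq_0.
  eapply Rle_lt_trans; [apply Cmod_mul_pow_le|]; assumption.
Qed.

Definition qcoef (t q : C) (j : nat) : C := fpoch t q j / fpoch q q j.

Lemma qcoef_S (t q : C) (j : nat) : (Cmod q < 1)%R ->
  (1 - q * q ^ j) * qcoef t q (S j) = (1 - t * q ^ j) * qcoef t q j.
Proof.
  intros Hq. unfold qcoef. rewrite !fpoch_S. field. split.
  - apply fpoch_neq_0; assumption.
  - apply one_minus_mul_pow_neq_0; assumption.
Qed.

Lemma qcoef_bounded (t q : C) : (Cmod q < 1)%R ->
  exists B : R, (0 <= B)%R /\ forall j, (Cmod (qcoef t q j) <= B)%R.
Proof.
  intros Hq. destruct (fpoch_bounded t q Hq) as [B HB].
  destruct (fpoch_bounded_below q q Hq Hq) as [c [Hc H]].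
  assert (HB0 : (0 <= B)%R).
  { specialize (HB O). pose proof (Cmod_ge_0 (fpoch t q 0)). lra. }
  exists (B * / c)%R. split.
  { apply Rmult_le_pos; [exact HB0|]. left. apply Rinv_0_lt_compat, Hc. }
  intros j. unfold qcoef.
  rewrite Cmod_div by (apply fpoch_neq_0; assumption).
  apply Rmult_le_compat; [apply Cmod_ge_0| | apply HB |].
  - left. apply Rinv_0_lt_compat. specialize (H j). lra.
  - apply Rinv_le_contravar; [exact Hc | apply H].
Qed.

Definition qbin_series (t q x : C) : C :=
  CSeries (fun j => qcoef t q j * x ^ j).

Lemma qbin_series_correct (t q x : C) : (Cmod q < 1)%R -> (Cmod x < 1)%R ->
  Cser (fun j => qcoef t q j * x ^ j) (qbin_series t q x).
Proof.
  intros Hq Hx. apply CSeries_correct.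
  destruct (qcoef_bounded t q Hq) as [B [HB0 HB]].
  apply (Cser_ex _ B (Cmod x)); [split; [apply Cmod_ge_0 | exact Hx]|].
  intros k. rewrite Cmod_mult, Cmod_pow. apply Rmult_le_compat_r; [|apply HB].
  apply pow_le, Cmod_ge_0.
Qed.

(** With [F] the series, the equation reads [F(x) - F(x q) = x (F(x) - t F(x q))]. The constant term
    on the left cancels, and comparing coefficients of [x ^ (k + 1)] gives [qcoef_S]. *)
Lemma qbin_series_step (t q x : C) : (Cmod q < 1)%R -> (Cmod x < 1)%R ->
  (1 - x) * qbin_series t q x = (1 - t * x) * qbin_series t q (x * q).
Proof.
  intros Hq Hx.
  assert (Hxq : (Cmod (x * q) < 1)%R).
  { pose proof (Cmod_mul_pow_le x q 1 Hq) as H.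
    rewrite Cpow_1_r in H. lra. }
  pose proof (qbin_series_correct t q x Hq Hx) as H1.
  pose proof (qbin_series_correct t q (x * q) Hq Hxq) as H2.
  set (S1 := qbin_series t q x) in *. set (S2 := qbin_series t q (x * q)) in *.
  pose proof (Cser_minus _ _ _ _ H1 H2) as H3.
  pose proof (Cser_minus _ _ _ _ (Cser_scal x _ _ H1)
    (Cser_scal (t * x) _ _ H2)) as H4.
  assert (E : S1 - S2 = 0 + (x * S1 - t * x * S2)).
  { apply (Ccv_unique _ _ _ H3).
    replace (RtoC 0)
      with (qcoef t q 0 * x ^ 0 - qcoef t q 0 * (x * q) ^ 0) by (simpl; ring).
    apply (Cser_shift
      (fun k => qcoef t q k * x ^ k - qcoef t q k * (x * q) ^ k)).
    refine (Cser_ext _ _ _ _ H4). intros k. cbv beta.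
    rewrite !Cpow_mult_l, !Cpow_S.
    transitivity (x * x ^ k * ((1 - t * q ^ k) * qcoef t q k)); [ring|].
    rewrite <- qcoef_S by exact Hq. ring. }
  replace ((1 - x) * S1) with ((S1 - S2) - x * S1 + S2) by ring.
  rewrite E. ring.
Qed.

Lemma qbin_series_iter (t q x : C) (n : nat) :
  (Cmod q < 1)%R -> (Cmod x < 1)%R ->
  fpoch x q n * qbin_series t q x
    = fpoch (t * x) q n * qbin_series t q (x * q ^ n).
Proof.
  intros Hq Hx. induction n as [|n IH].
  - replace (x * q ^ 0) with x by (simpl; ring). unfold fpoch. simpl. ring.
  - rewrite !fpoch_S.
    replace (x * q ^ S n) with (x * q ^ n * q) by (rewrite Cpow_S; ring).
    transitivity ((1 - x * q ^ n) * (fpoch x q n * qbin_series t q x)); [ring|].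
    rewrite IH.
    transitivity (fpoch (t * x) q n
      * ((1 - x * q ^ n) * qbin_series t q (x * q ^ n))); [ring|].
    rewrite qbin_series_step; [ring | exact Hq |].
    eapply Rle_lt_trans; [apply Cmod_mul_pow_le|]; assumption.
Qed.

Lemma qbin_series_cv_1 (t q x : C) : (Cmod q < 1)%R -> (Cmod x < 1)%R ->
  Ccv (fun n => qbin_series t q (x * q ^ n)) 1.
Proof.
  intros Hq Hx. destruct (qcoef_bounded t q Hq) as [B [HB0 HB]].
  assert (Hxn : forall n, (Cmod (x * q ^ n) <= Cmod x)%R)
    by (intros; apply Cmod_mul_pow_le, Hq).
  assert (Hz : Ccv (fun n => x * q ^ n) 0).
  { apply (Ccv_0_geometric _ (Cmod x) (Cmod q)).
    - split; [apply Cmod_ge_0 | exact Hq].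
    - intros n. rewrite Cmod_mult, Cmod_pow. lra. }
  apply (tannery (fun n j => qcoef t q j * (x * q ^ n) ^ j)
    (fun j => qcoef t q j * 0 ^ j) _ _ B (Cmod x)).
  - split; [apply Cmod_ge_0 | exact Hx].
  - intros n j. rewrite Cmod_mult, Cmod_pow.
    apply Rmult_le_compat; try apply pow_le; try apply Cmod_ge_0; [apply HB|].
    apply pow_incr. split; [apply Cmod_ge_0 | apply Hxn].
  - intros j. apply Ccv_scal. apply (Ccv_pow (fun n => x * q ^ n)), Hz.
  - intros n. apply qbin_series_correct; [exact Hq|].
    eapply Rle_lt_trans; [apply Hxn | exact Hx].
  - replace (RtoC 1) with (Csum (fun j => qcoef t q j * 0 ^ j) 1).
    + apply Cser_finite. intros [|k] Hk; [lia|]. simpl. ring.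
    + unfold qcoef, fpoch. simpl. field.
Qed.

Lemma fpoch_0 (q : C) (n : nat) : fpoch 0 q n = 1.
Proof.
  induction n as [|n IH]; [reflexivity|]. rewrite fpoch_S, IH. ring.
Qed.

(** At [t = 0] the iterated functional equation says that [(x; q)_n F(x) = F(x q ^ n)], which tends
    to 1. This single fact gives convergence of the infinite product, its value, and [F(x) <> 0],
    without logarithms. *)
Lemma fpoch_qbin_series_cv (q x : C) : (Cmod q < 1)%R -> (Cmod x < 1)%R ->
  qbin_series 0 q x <> 0 /\ Ccv (fpoch x q) (/ qbin_series 0 q x).
Proof.
  intros Hq Hx. set (F := qbin_series 0 q x).
  assert (H : Ccv (fun n => F * fpoch x q n) 1).
  { apply (Ccv_ext (fun n => qbin_series 0 q (x * q ^ n))).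
    - intros n. rewrite (Cmult_comm F). unfold F.
      rewrite qbin_series_iter by assumption.
      replace (0 * x) with (RtoC 0) by ring. rewrite fpoch_0. ring.
    - apply qbin_series_cv_1; assumption. }
  assert (HF : F <> 0).
  { intros E. assert (E1 : RtoC 1 = 0).
    { apply (Ccv_unique _ _ _ H). apply (Ccv_ext (fun _ => RtoC 0)).
      - intros n. rewrite E. ring.
      - apply Ccv_const. }
    apply (f_equal fst) in E1. simpl in E1. lra. }
  split; [exact HF|].
  replace (/ F) with (/ F * 1) by ring.
  apply (Ccv_ext (fun n => / F * (F * fpoch x q n))).
  - intros n. field. exact HF.
  - apply Ccv_scal, H.
Qed.

Lemma qpoch_inf_eq (q x : C) : (Cmod q < 1)%R -> (Cmod x < 1)%R ->
  qpoch_inf x q = / qbin_series 0 q x.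
Proof.
  intros Hq Hx. unfold qpoch_inf, Cprod_inf.
  apply (@iota_filterlim_locally C_AbsRing C_CompleteNormedModule nat
    eventually _ (fpoch x q)).
  apply (Ccv_filterlim (fpoch x q)).
  apply fpoch_qbin_series_cv; assumption.
Qed.

Lemma fpoch_cv (q x : C) : (Cmod q < 1)%R -> (Cmod x < 1)%R ->
  Ccv (fpoch x q) (qpoch_inf x q).
Proof.
  intros Hq Hx. rewrite qpoch_inf_eq by assumption.
  apply fpoch_qbin_series_cv; assumption.
Qed.

Lemma qpoch_inf_neq_0 (q x : C) : (Cmod q < 1)%R -> (Cmod x < 1)%R ->
  qpoch_inf x q <> 0.
Proof.
  intros Hq Hx. rewrite qpoch_inf_eq by assumption.
  destruct (fpoch_qbin_series_cv q x Hq Hx) as [HF _].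
  intros E. apply HF.
  replace (qbin_series 0 q x)
    with (qbin_series 0 q x * (qbin_series 0 q x * / qbin_series 0 q x))
    by (field; exact HF).
  rewrite E. ring.
Qed.

(** The case [t = 0] of the q-binomial theorem. It evaluates the limit of [G_N] and later yields
    continuity of [1 / (x; q)_oo] in [x]. *)
Lemma euler_series (q x : C) : (Cmod q < 1)%R -> (Cmod x < 1)%R ->
  Cser (fun j => x ^ j / fpoch q q j) (/ qpoch_inf x q).
Proof.
  intros Hq Hx. rewrite qpoch_inf_eq by assumption.
  destruct (fpoch_qbin_series_cv q x Hq Hx) as [HF _].
  replace (/ / qbin_series 0 q x) with (qbin_series 0 q x) by (field; exact HF).
  refine (Cser_ext _ _ _ _ (qbin_series_correct 0 q x Hq Hx)).
  intros k. unfold qcoef. rewrite fpoch_0. field.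
  apply fpoch_neq_0; assumption.
Qed.

(** Let [n -> oo] in [qbin_series_iter]: both finite products converge and the shifted series tends
    to 1. *)
Lemma qbinomial_theorem (t q x : C) :
  (Cmod q < 1)%R -> (Cmod x < 1)%R -> (Cmod (t * x) < 1)%R ->
  Cser (fun j => qcoef t q j * x ^ j) (qpoch_inf (t * x) q / qpoch_inf x q).
Proof.
  intros Hq Hx Htx.
  replace (qpoch_inf (t * x) q / qpoch_inf x q) with (qbin_series t q x).
  { apply qbin_series_correct; assumption. }
  assert (E : qbin_series t q x * qpoch_inf x q = qpoch_inf (t * x) q * 1).
  { apply (Ccv_unique (fun n => qbin_series t q x * fpoch x q n)).
    - apply Ccv_scal, fpoch_cv; assumption.
    - apply (Ccv_ext
        (fun n => fpoch (t * x) q n * qbin_series t q (x * q ^ n))).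
      + intros n. rewrite <- qbin_series_iter by assumption. ring.
      + apply Ccv_mult; [apply fpoch_cv | apply qbin_series_cv_1]; assumption. }
  replace (qpoch_inf (t * x) q) with (qbin_series t q x * qpoch_inf x q)
    by (rewrite E; ring).
  field. apply qpoch_inf_neq_0; assumption.
Qed.

Lemma qpoch_fpoch (a q : C) (n : nat) : (Cmod q < 1)%R -> (Cmod a < 1)%R ->
  qpoch a q n = fpoch a q n.
Proof.
  intros Hq Ha.
  assert (Han : (Cmod (a * q ^ n) < 1)%R).
  { eapply Rle_lt_trans; [apply Cmod_mul_pow_le|]; assumption. }
  unfold qpoch.
  replace (qpoch_inf a q) with (fpoch a q n * qpoch_inf (a * q ^ n) q).
  - field. apply qpoch_inf_neq_0; assumption.
  - apply (Ccv_unique (fun m => fpoch a q (n + m))).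
    + apply (Ccv_ext (fun m => fpoch a q n * fpoch (a * q ^ n) q m)).
      * intros m. symmetry. apply fpoch_add.
      * apply Ccv_scal, fpoch_cv; assumption.
    + apply (Ccv_subseq (fpoch a q)); [intros; lia|].
      apply fpoch_cv; assumption.
Qed.

(** * Rogers polynomials *)

(* With [z = e^(2 i theta)], this is [z ^ (N / 2)] times the continuous
   q-ultraspherical polynomial [C_N(cos theta; t | q)]. *)
Definition rogers (t q z : C) (N : nat) : C :=
  Csum (fun j => qcoef t q (N - j) * qcoef t q j * z ^ j) (S N).

(** At [t = 0] the coefficient [qcoef] is [1 / (q; q)_j], so the prefactor turns the summands into
    q-binomial coefficients times [z ^ j]. *)
Definition rogers_szego (q z : C) (N : nat) : C :=
  fpoch q q N * rogers 0 q z N.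

Definition rogers_ratio (t q z : C) (N : nat) : C :=
  fpoch q q N / fpoch (t ^ 2) q N * rogers t q z N.

Lemma qcoef_0 (t q : C) : qcoef t q 0 = 1.
Proof. unfold qcoef, fpoch. simpl. field. Qed.

Lemma rogers_0 (t q z : C) : rogers t q z 0 = 1.
Proof. unfold rogers. simpl. rewrite qcoef_0. ring. Qed.

(* The coefficients of each power of [z] already cancel separately. *)
Lemma rogers_rec_SS (t q z : C) (N : nat) : (Cmod q < 1)%R ->
  (1 - q * q ^ S N) * rogers t q z (S (S N))
    = (1 - t * q ^ S N) * (1 + z) * rogers t q z (S N)
      - (1 - t ^ 2 * q ^ N) * z * rogers t q z N.
Proof.
  intros Hq.
  set (F1 := fun j => qcoef t q (S (N - j)) * qcoef t q (S j) * z ^ S j).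
  set (F2 := fun j => qcoef t q (N - j) * qcoef t q (S j) * z ^ S j).
  set (F3 := fun j => qcoef t q (S (N - j)) * qcoef t q j * z ^ j).
  set (F4 := fun j => qcoef t q (N - j) * qcoef t q j * z ^ j).
  assert (E1 : rogers t q z (S (S N))
    = qcoef t q (S (S N)) + Csum F1 (S N) + qcoef t q (S (S N)) * z ^ S (S N)).
  { unfold rogers. rewrite Csum_shift.
    match goal with |- _ + Csum ?f (S (S N)) = _ =>
      change (Csum f (S (S N))) with (Csum f (S N) + f (S N)) end.
    cbv beta. rewrite Nat.sub_diag, Nat.sub_0_r, qcoef_0.
    rewrite (Csum_ext _ F1).
    - simpl (z ^ 0). ring.
    - intros k Hk. unfold F1.
      replace (S (S N) - S k)%nat with (S (N - k)) by lia. reflexivity. }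
  (* The factor [1 + z] is split: the copy multiplied by 1 loses its bottom term here, and the copy
     multiplied by [z] loses its top term in [E3]. All four remaining sums then have the same range
     and meet at the power [z ^ (j + 1)]. *)
  assert (E2 : rogers t q z (S N) = qcoef t q (S N) + Csum F2 (S N)).
  { unfold rogers. rewrite Csum_shift.
    rewrite Nat.sub_0_r, qcoef_0. rewrite (Csum_ext _ F2).
    - simpl (z ^ 0). ring.
    - intros k Hk. unfold F2. reflexivity. }
  assert (E3 : rogers t q z (S N) = Csum F3 (S N) + qcoef t q (S N) * z ^ S N).
  { unfold rogers.
    match goal with |- Csum ?f (S (S N)) = _ =>
      change (Csum f (S (S N))) with (Csum f (S N) + f (S N)) end.
    cbv beta. rewrite Nat.sub_diag, qcoef_0. rewrite (Csum_ext _ F3).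
    - ring.
    - intros k Hk. unfold F3.
      replace (S N - k)%nat with (S (N - k)) by lia. reflexivity. }
  assert (E4 : rogers t q z N = Csum F4 (S N)) by reflexivity.
  assert (E : Csum (fun j => (1 - q * q ^ S N) * F1 j
      + ((- (1 - t * q ^ S N)) * F2 j
      + ((- ((1 - t * q ^ S N) * z)) * F3 j
      + (1 - t ^ 2 * q ^ N) * z * F4 j))) (S N) = 0).
  { transitivity (Csum (fun _ => 0 * 0) (S N)); [|rewrite Csum_scal; ring].
    apply Csum_ext. intros j Hj. unfold F1, F2, F3, F4.
    assert (HN : exists i, N = (i + j)%nat) by (exists (N - j)%nat; lia).
    destruct HN as [i ->].
    replace (i + j - j)%nat with i by lia.
    assert (Hi : 1 - q * q ^ i <> 0)
      by (apply one_minus_mul_pow_neq_0; assumption).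
    assert (Hj' : 1 - q * q ^ j <> 0)
      by (apply one_minus_mul_pow_neq_0; assumption).
    replace (qcoef t q (S i)) with ((1 - t * q ^ i) * qcoef t q i / (1 - q * q ^ i))
      by (rewrite <- qcoef_S by exact Hq; field; exact Hi).
    replace (qcoef t q (S j)) with ((1 - t * q ^ j) * qcoef t q j / (1 - q * q ^ j))
      by (rewrite <- qcoef_S by exact Hq; field; exact Hj').
    rewrite !Cpow_S, Cpow_add_r. field. split; assumption. }
  rewrite !Csum_plus, !Csum_scal in E.
  (* This matches the two end terms left over, of degrees 0 and [N + 2] in [z]. *)
  pose proof (qcoef_S t q (S N) Hq) as Hc.
  transitivity ((1 - t * q ^ S N) * rogers t q z (S N)
    + (1 - t * q ^ S N) * z * rogers t q z (S N)
      - (1 - t ^ 2 * q ^ N) * z * rogers t q z N); [|ring].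
  rewrite E2 at 1. rewrite E3, E4, E1.
  set (c2 := qcoef t q (S (S N))) in *. set (c1 := qcoef t q (S N)) in *.
  replace ((1 - q * q ^ S N) * (c2 + Csum F1 (S N) + c2 * z ^ S (S N)))
    with ((1 - q * q ^ S N) * c2 * (1 + z ^ S (S N))
      + (1 - q * q ^ S N) * Csum F1 (S N)) by ring.
  replace ((1 - q * q ^ S N) * Csum F1 (S N)) with
    ((1 - t * q ^ S N) * Csum F2 (S N)
     + (1 - t * q ^ S N) * z * Csum F3 (S N)
     - (1 - t ^ 2 * q ^ N) * z * Csum F4 (S N)).
  - rewrite Hc, !Cpow_S. ring.
  - match type of E with ?x + _ = _ =>
      transitivity (x - (RtoC 0)); [rewrite <- E|]; ring end.
Qed.

(* [pred 0 = 0], but the last term carries the factor [1 - q ^ 0 = 0]. *)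
Lemma rogers_ratio_rec (t q z : C) (N : nat) :
  (Cmod q < 1)%R -> (Cmod t < 1)%R ->
  (1 - t ^ 2 * q ^ N) * rogers_ratio t q z (S N)
    = (1 - t * q ^ N) * (1 + z) * rogers_ratio t q z N
      - (1 - q ^ N) * z * rogers_ratio t q z (pred N).
Proof.
  intros Hq Ht.
  assert (Ht2 : (Cmod (t ^ 2) < 1)%R).
  { rewrite Cmod_pow. pose proof (Cmod_ge_0 t). nra. }
  unfold rogers_ratio. destruct N as [|N].
  - assert (H1 : 1 - t ^ 2 <> 0) by (apply one_minus_neq_0; exact Ht2).
    assert (H2 : 1 - q <> 0) by (apply one_minus_neq_0; exact Hq).
    unfold rogers, qcoef, fpoch. simpl. field.
    split; intros E; [apply H2 | apply H1]; rewrite <- E; ring.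
  - pose proof (rogers_rec_SS t q z N Hq) as E. simpl pred.
    rewrite !fpoch_S.
    assert (H1 : 1 - t ^ 2 * q ^ N <> 0)
      by (apply one_minus_mul_pow_neq_0; assumption).
    assert (H2 : 1 - t ^ 2 * q ^ S N <> 0)
      by (apply one_minus_mul_pow_neq_0; assumption).
    assert (H3 : fpoch (t ^ 2) q N <> 0) by (apply fpoch_neq_0; assumption).
    transitivity (fpoch q q N * (1 - q * q ^ N)
      / (fpoch (t ^ 2) q N * (1 - t ^ 2 * q ^ N))
      * ((1 - q * q ^ S N) * rogers t q z (S (S N)))).
    { field. repeat split; assumption. }
    rewrite E, !(Cpow_S q). field. rewrite !(Cpow_S q) in H2.
    repeat split; assumption.
Qed.

(** At [t = 0] the denominator [(t ^ 2; q)_N] is 1 and [rogers_ratio] becomes [rogers_szego]. *)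
Lemma rogers_szego_rec (q z : C) (N : nat) : (Cmod q < 1)%R ->
  rogers_szego q z (S N)
    = (1 + z) * rogers_szego q z N
      - (1 - q ^ N) * z * rogers_szego q z (pred N).
Proof.
  intros Hq.
  assert (E : forall M, rogers_ratio 0 q z M = rogers_szego q z M).
  { intros M. unfold rogers_ratio, rogers_szego.
    replace (0 ^ 2) with (RtoC 0) by ring. rewrite fpoch_0. field. }
  assert (H0 : (Cmod 0 < 1)%R) by (rewrite Cmod_0; lra).
  pose proof (rogers_ratio_rec 0 q z N Hq H0) as H. rewrite !E in H.
  transitivity ((1 - 0 ^ 2 * q ^ N) * rogers_szego q z (S N)); [ring|].
  rewrite H. ring.
Qed.

(** * Bounds and limits of the Rogers polynomials *)

Lemma Cmod_Csum_le (f : nat -> C) (B : R) (n : nat) :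
  (forall k, (k < n)%nat -> (Cmod (f k) <= B)%R) ->
  (Cmod (Csum f n) <= B * INR n)%R.
Proof.
  induction n as [|n IH]; intros H.
  - simpl. rewrite Cmod_0. lra.
  - rewrite S_INR. simpl Csum. eapply Rle_trans; [apply Cmod_triangle|].
    specialize (IH ltac:(intros; apply H; lia)). specialize (H n ltac:(lia)).
    lra.
Qed.

(** The polynomial has [N + 1] coefficients, bounded uniformly. The constant is independent of [z],
    as the radial limit onto the unit circle requires. *)
Lemma rogers_szego_bound (q : C) : (Cmod q < 1)%R ->
  exists B : R, (0 <= B)%R /\ forall z N, (Cmod z <= 1)%R ->
    (Cmod (rogers_szego q z N) <= B * (INR N + 1))%R.
Proof.
  intros Hq. destruct (qcoef_bounded 0 q Hq) as [B [HB0 HB]].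
  destruct (fpoch_bounded q q Hq) as [A HA].
  assert (HA0 : (0 <= A)%R).
  { specialize (HA O). pose proof (Cmod_ge_0 (fpoch q q 0)). lra. }
  exists (A * (B * B))%R. split.
  { repeat apply Rmult_le_pos; assumption. }
  intros z N Hz. unfold rogers_szego. rewrite Cmod_mult, Rmult_assoc.
  apply Rmult_le_compat; try apply Cmod_ge_0; [apply HA|].
  rewrite <- S_INR. apply Cmod_Csum_le. intros k Hk.
  rewrite !Cmod_mult, Cmod_pow. rewrite <- (Rmult_1_r (B * B)).
  apply Rmult_le_compat.
  - apply Rmult_le_pos; apply Cmod_ge_0.
  - apply pow_le, Cmod_ge_0.
  - apply Rmult_le_compat; try apply Cmod_ge_0; apply HB.
  - rewrite <- (pow1 k). apply pow_incr. split; [apply Cmod_ge_0 | exact Hz].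
Qed.

Lemma rogers_term_bound (t q : C) : (Cmod q < 1)%R ->
  exists B : R, (0 <= B)%R /\ forall z N j,
    (Cmod (qcoef t q (N - j) * qcoef t q j * z ^ j) <= B * Cmod z ^ j)%R.
Proof.
  intros Hq. destruct (qcoef_bounded t q Hq) as [B [HB0 HB]].
  exists (B * B)%R. split; [apply Rmult_le_pos; exact HB0|].
  intros z N j. rewrite !Cmod_mult, Cmod_pow.
  apply Rmult_le_compat_r; [apply pow_le, Cmod_ge_0|].
  apply Rmult_le_compat; try apply Cmod_ge_0; apply HB.
Qed.

(** Inside the disc the geometric series in [|z|] removes the growth in [N]; a bound free of [N] is
    what dominated convergence for [N -> oo] requires. *)
Lemma rogers_szego_bound_lt1 (q z : C) : (Cmod q < 1)%R -> (Cmod z < 1)%R ->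
  exists B : R, (0 <= B)%R /\ forall N, (Cmod (rogers_szego q z N) <= B)%R.
Proof.
  intros Hq Hz. destruct (rogers_term_bound 0 q Hq) as [B [HB0 HB]].
  destruct (fpoch_bounded q q Hq) as [A HA].
  assert (HA0 : (0 <= A)%R).
  { specialize (HA O). pose proof (Cmod_ge_0 (fpoch q q 0)). lra. }
  assert (Hz' : (0 <= Cmod z < 1)%R) by (split; [apply Cmod_ge_0 | exact Hz]).
  exists (A * (B / (1 - Cmod z) * Cmod z ^ 0))%R. split.
  { apply Rmult_le_pos; [exact HA0|]. rewrite Rmult_1_r.
    apply Rmult_le_pos; [exact HB0|]. left. apply Rinv_0_lt_compat. lra. }
  intros N. unfold rogers_szego. rewrite Cmod_mult.
  apply Rmult_le_compat; try apply Cmod_ge_0; [apply HA|].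
  pose proof (Csum_tail (fun j => qcoef 0 q (N - j) * qcoef 0 q j * z ^ j)
    B (Cmod z) 0 (S N) Hz' (fun j => HB z N j) ltac:(lia)) as H.
  eapply Rle_trans; [right; apply (f_equal Cmod) | exact H].
  transitivity (rogers 0 q z N - 0); [ring | reflexivity].
Qed.

(** For fixed [j] the factor [qcoef t q (N - j)] tends to [(t; q)_oo / (q; q)_oo], and the remaining
    series is that of the q-binomial theorem. *)
Lemma rogers_cv (t q z : C) :
  (Cmod q < 1)%R -> (Cmod t < 1)%R -> (Cmod z < 1)%R ->
  Ccv (rogers t q z) (qpoch_inf t q / qpoch_inf q q
    * (qpoch_inf (t * z) q / qpoch_inf z q)).
Proof.
  intros Hq Ht Hz. destruct (rogers_term_bound t q Hq) as [B [HB0 HB]].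
  assert (Htz : (Cmod (t * z) < 1)%R).
  { rewrite Cmod_mult. pose proof (Cmod_ge_0 t). pose proof (Cmod_ge_0 z). nra. }
  (* For [j > N] the truncated [N - j] is 0 and would leave a spurious term, so the summand is cut
     off explicitly. *)
  set (f := fun N j => if (j <=? N)%nat
    then qcoef t q (N - j) * qcoef t q j * z ^ j else 0).
  apply (tannery f (fun j => qpoch_inf t q / qpoch_inf q q * (qcoef t q j * z ^ j))
    _ _ B (Cmod z)).
  - split; [apply Cmod_ge_0 | exact Hz].
  - intros N j. unfold f. destruct (j <=? N)%nat; [apply HB|].
    rewrite Cmod_0. apply Rmult_le_pos; [exact HB0 | apply pow_le, Cmod_ge_0].
  - intros j.
    assert (Hc : Ccv (qcoef t q) (qpoch_inf t q / qpoch_inf q q)).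
    { apply Ccv_mult; [apply fpoch_cv; assumption|].
      apply Ccv_inv; [apply qpoch_inf_neq_0 | apply fpoch_cv]; assumption. }
    intros eps Heps.
    destruct (Ccv_mult _ _ _ _ Hc (Ccv_const (qcoef t q j * z ^ j)) eps Heps)
      as [N HN].
    exists (N + j)%nat. intros n Hn. unfold f.
    rewrite (proj2 (Nat.leb_le j n)) by lia.
    specialize (HN (n - j)%nat ltac:(lia)). cbv beta in HN.
    rewrite <- Cmult_assoc. exact HN.
  - intros N. unfold rogers.
    rewrite (Csum_ext _ (f N)).
    + apply Cser_finite. intros k Hk. unfold f.
      rewrite (proj2 (Nat.leb_gt k N)) by lia. reflexivity.
    + intros k Hk. unfold f. rewrite (proj2 (Nat.leb_le k N)) by lia. reflexivity.
  - apply Cser_scal, qbinomial_theorem; assumption.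
Qed.

Lemma rogers_szego_cv (q z : C) : (Cmod q < 1)%R -> (Cmod z < 1)%R ->
  Ccv (rogers_szego q z) (/ qpoch_inf z q).
Proof.
  intros Hq Hz. assert (H0 : (Cmod 0 < 1)%R) by (rewrite Cmod_0; lra).
  assert (E : qpoch_inf 0 q = 1).
  { apply (Ccv_unique (fpoch 0 q)); [apply fpoch_cv; assumption|].
    apply (Ccv_ext (fun _ => RtoC 1)); [|apply Ccv_const].
    intros n. symmetry. apply fpoch_0. }
  replace (/ qpoch_inf z q) with (qpoch_inf q q * (qpoch_inf 0 q / qpoch_inf q q
    * (qpoch_inf (0 * z) q / qpoch_inf z q))).
  - apply Ccv_mult; [apply fpoch_cv | apply rogers_cv]; assumption.
  - replace (0 * z) with (RtoC 0) by ring. rewrite E. field.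
    split; apply qpoch_inf_neq_0; assumption.
Qed.

Lemma rogers_ratio_cv (t q z : C) :
  (Cmod q < 1)%R -> (Cmod t < 1)%R -> (Cmod z < 1)%R ->
  Ccv (rogers_ratio t q z) (qpoch_inf t q * qpoch_inf (t * z) q
    / (qpoch_inf (t ^ 2) q * qpoch_inf z q)).
Proof.
  intros Hq Ht Hz.
  assert (Ht2 : (Cmod (t ^ 2) < 1)%R).
  { rewrite Cmod_pow. pose proof (Cmod_ge_0 t). nra. }
  pose proof (qpoch_inf_neq_0 q q Hq Hq) as H1.
  pose proof (qpoch_inf_neq_0 q z Hq Hz) as H2.
  pose proof (qpoch_inf_neq_0 q (t ^ 2) Hq Ht2) as H3.
  replace (qpoch_inf t q * qpoch_inf (t * z) q
    / (qpoch_inf (t ^ 2) q * qpoch_inf z q)) with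
    (qpoch_inf q q * / qpoch_inf (t ^ 2) q * (qpoch_inf t q / qpoch_inf q q
    * (qpoch_inf (t * z) q / qpoch_inf z q)))
    by (field; repeat split; assumption).
  apply Ccv_mult; [apply Ccv_mult|].
  - apply fpoch_cv; assumption.
  - apply Ccv_inv; [assumption | apply fpoch_cv; assumption].
  - apply rogers_cv; assumption.
Qed.

(** * The recurrence in [N] and the evaluation of [G_0] *)

(* Always used with [w = t / z]. *)
Definition cb_term (t q z w : C) (N k : nat) : C :=
  w ^ k * rogers_szego q z (N + 2 * k) / (fpoch q q k * fpoch (t * q) q (N + k)).

Definition cb_sum (t q z w : C) (N : nat) : C := CSeries (cb_term t q z w N).

(** The recurrence of [H] reduces the combination of summands in [cb_term_telescope] to [H_(N+2k-1)]
    and [H_(N+2k+1)]; the certificate is the coefficient of the former. The coefficient of the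
    latter contains [(1 - t q^N) (1 - t q^(N+k+1)) - (1 - t^2 q^N) = - t q^N (1 + q^(k+1) - t - t
    q^(N+k+1))], and [t w^k = z w^(k+1)] makes it minus the certificate at [k + 1]. The factor
    [1 - q ^ k] makes the boundary term vanish and hides the index [pred 0]. *)
Definition cb_cert (t q z w : C) (N k : nat) : C :=
  z * q ^ N * (1 + q ^ k - t - t * q ^ (N + k)) * (1 - q ^ k)
  * (w ^ k * rogers_szego q z (pred (N + 2 * k))
     / (fpoch q q k * fpoch (t * q) q (N + k))).

Lemma Cmod_mul_lt_1 (a b : C) :
  (Cmod a < 1)%R -> (Cmod b <= 1)%R -> (Cmod (a * b) < 1)%R.
Proof.
  intros Ha Hb. rewrite Cmod_mult.
  pose proof (Cmod_ge_0 a). pose proof (Cmod_ge_0 b). nra.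
Qed.

Lemma cb_term_telescope (t q z w : C) (N k : nat) :
  (Cmod q < 1)%R -> (Cmod t < 1)%R -> t = w * z ->
  (1 - t * q ^ N) * (1 + z) * cb_term t q z w N k
    - (1 - q ^ N) * z * cb_term t q z w (pred N) k
    - (1 - t ^ 2 * q ^ N) * cb_term t q z w (S N) k
  = cb_cert t q z w N k - cb_cert t q z w N (S k).
Proof.
  intros Hq Ht Hw.
  assert (Htq : (Cmod (t * q) < 1)%R) by (apply Cmod_mul_lt_1; lra).
  assert (D1 : fpoch q q k <> 0) by (apply fpoch_neq_0; assumption).
  assert (D2 : 1 - q * q ^ k <> 0)
    by (apply one_minus_mul_pow_neq_0; assumption).
  assert (D3 : fpoch (t * q) q (N + k) <> 0) by (apply fpoch_neq_0; assumption).
  assert (D4 : 1 - t * q * (q ^ N * q ^ k) <> 0).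
  { rewrite <- Cpow_add_r. apply one_minus_mul_pow_neq_0; assumption. }
  set (h0 := rogers_szego q z (pred (N + 2 * k))).
  set (h1 := rogers_szego q z (S (N + 2 * k))).
  assert (E1 : (1 + z) * rogers_szego q z (N + 2 * k)
      = h1 + (1 - q ^ N * (q ^ k * q ^ k)) * z * h0).
  { unfold h0, h1. rewrite (rogers_szego_rec q z (N + 2 * k) Hq).
    replace (q ^ (N + 2 * k)) with (q ^ N * (q ^ k * q ^ k)).
    - ring.
    - simpl. rewrite Nat.add_0_r, !Cpow_add_r. reflexivity. }
  assert (E2 : (1 - q ^ N) * z * cb_term t q z w (pred N) k
      = (1 - q ^ N) * z * (w ^ k * h0 * (1 - t * (q ^ N * q ^ k))
        / (fpoch q q k * fpoch (t * q) q (N + k)))).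
  { destruct N as [|N]; [simpl (q ^ 0); ring|].
    unfold cb_term, h0. change (pred (S N)) with N.
    change (pred (S N + 2 * k)) with (N + 2 * k)%nat.
    change (S N + k)%nat with (S (N + k)) in D3 |- *.
    rewrite fpoch_S, (Cpow_add_r q) in D3 |- *. rewrite (Cpow_S q).
    field. repeat split; try assumption.
    all: intros E; apply D3; rewrite E; ring. }
  assert (E3 : (1 - t * q ^ N) * (1 + z) * cb_term t q z w N k
      = (1 - t * q ^ N) * (w ^ k * (h1 + (1 - q ^ N * (q ^ k * q ^ k)) * z * h0)
        / (fpoch q q k * fpoch (t * q) q (N + k)))).
  { rewrite <- E1. unfold cb_term. field. split; assumption. }
  rewrite E2, E3. unfold cb_term, cb_cert. fold h0.
  replace (S N + 2 * k)%nat with (S (N + 2 * k)) by lia. fold h1.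
  replace (pred (N + 2 * S k)) with (S (N + 2 * k)) by lia. fold h1.
  replace (N + S k)%nat with (S (N + k)) by lia.
  replace (S N + k)%nat with (S (N + k)) by lia.
  rewrite !fpoch_S, !Cpow_S, !Cpow_add_r.
  clearbody h0 h1. clear E1 E2 E3.
  set (P1 := fpoch q q k) in *. set (P2 := fpoch (t * q) q (N + k)) in *.
  clearbody P1 P2. subst t. field. repeat split; assumption.
Qed.

Lemma linear_mul_pow_bound (x : R) : (0 <= x < 1)%R ->
  exists D r : R, (0 <= D)%R /\ (0 <= r < 1)%R /\
    forall (y : R) (N k : nat), (0 <= y <= x)%R ->
      (y ^ k * (INR (N + 2 * k) + 1) <= D * (INR N + 1) * r ^ k)%R.
Proof.
  (* This [h] leaves room for the ratio [x (1 + h) < 1], while by Bernoulli's inequality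
     [(1 + h) ^ k] absorbs the linear factor in [k]. *)
  intros Hx. set (h := ((1 - x) / 2)%R).
  assert (Hh : (0 < h <= 1)%R) by (unfold h; lra).
  exists (2 / h)%R, (x * (1 + h))%R.
  assert (H2h : (0 < 2 / h)%R) by (apply Rdiv_lt_0_compat; lra).
  split; [lra|]. split.
  { split; [apply Rmult_le_pos; lra|]. unfold h. nra. }
  intros y N k Hy.
  assert (H1 : (y ^ k <= x ^ k)%R) by (apply pow_incr; exact Hy).
  assert (H0 : (0 <= y ^ k)%R) by (apply pow_le; lra).
  (* Turning the sum into a product separates [N] from [k]. *)
  assert (H2 : (INR (N + 2 * k) + 1 <= (INR N + 1) * (2 * INR k + 1))%R).
  { rewrite plus_INR, mult_INR. simpl (INR 2).
    pose proof (pos_INR N). pose proof (pos_INR k). nra. }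
  assert (H3 : (2 * INR k + 1 <= 2 / h * (1 + h) ^ k)%R).
  { pose proof (poly k h ltac:(lra)) as Hp.
    apply Rle_trans with (2 / h * (1 + INR k * h))%R.
    - replace (2 / h * (1 + INR k * h))%R with (2 * INR k + 2 / h)%R
        by (field; lra).
      assert (1 <= 2 / h)%R; [|lra].
      apply Rmult_le_reg_r with h; [lra|].
      replace (2 / h * h)%R with 2%R by (field; lra). lra.
    - apply Rmult_le_compat_l; lra. }
  rewrite Rpow_mult_distr.
  pose proof (pos_INR N) as HN.
  apply Rle_trans with (x ^ k * ((INR N + 1) * (2 / h * (1 + h) ^ k)))%R.
  - apply Rmult_le_compat; try assumption.
    + pose proof (pos_INR (N + 2 * k)). lra.
    + eapply Rle_trans; [exact H2|]. apply Rmult_le_compat_l; lra.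
  - right. ring.
Qed.

(** The free indices [M] and [m] let one majorant serve both the summands and the certificate;
    uniformity in [z] and [w] serves the limit onto the unit circle. *)
Lemma cb_bound (t q : C) (x : R) :
  (Cmod q < 1)%R -> (Cmod t < 1)%R -> (0 <= x < 1)%R ->
  exists D r : R, (0 <= D)%R /\ (0 <= r < 1)%R /\
    forall (z w : C) (N k M m : nat),
      (Cmod z <= 1)%R -> (Cmod w <= x)%R -> (M <= N + 2 * k)%nat ->
      (Cmod (w ^ k * rogers_szego q z M / (fpoch q q k * fpoch (t * q) q m))
        <= D * (INR N + 1) * r ^ k)%R.
Proof.
  intros Hq Ht Hx.
  assert (Htq : (Cmod (t * q) < 1)%R) by (apply Cmod_mul_lt_1; lra).
  destruct (linear_mul_pow_bound x Hx) as [D [r [HD [Hr H]]]].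
  destruct (rogers_szego_bound q Hq) as [B [HB0 HB]].
  destruct (fpoch_bounded_below q q Hq Hq) as [c1 [Hc1 H1]].
  destruct (fpoch_bounded_below (t * q) q Hq Htq) as [c2 [Hc2 H2]].
  assert (Hc : (0 < / (c1 * c2))%R).
  { apply Rinv_0_lt_compat, Rmult_lt_0_compat; assumption. }
  exists (B * / (c1 * c2) * D)%R, r. split.
  { repeat apply Rmult_le_pos; lra. }
  split; [exact Hr|]. intros z w N k M m Hz Hw HM.
  rewrite Cmod_div
    by (apply Cmult_neq_0; apply fpoch_neq_0; assumption).
  rewrite !Cmod_mult, Cmod_pow.
  pose proof (Cmod_ge_0 w) as Hw0.
  assert (Hs : (Cmod (rogers_szego q z M) <= B * (INR (N + 2 * k) + 1))%R).
  { eapply Rle_trans; [apply HB; exact Hz|]. apply Rmult_le_compat_l; [exact HB0|].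
    apply le_INR in HM. lra. }
  apply Rle_trans
    with (Cmod w ^ k * (B * (INR (N + 2 * k) + 1)) * / (c1 * c2))%R.
  - apply Rmult_le_compat.
    + apply Rmult_le_pos; [apply pow_le; exact Hw0 | apply Cmod_ge_0].
    + left. apply Rinv_0_lt_compat. specialize (H1 k). specialize (H2 m).
      apply Rmult_lt_0_compat; lra.
    + apply Rmult_le_compat_l; [apply pow_le; exact Hw0 | exact Hs].
    + apply Rinv_le_contravar; [apply Rmult_lt_0_compat; assumption|].
      apply Rmult_le_compat; auto; lra.
  - replace (Cmod w ^ k * (B * (INR (N + 2 * k) + 1)) * / (c1 * c2))%R
      with (B * / (c1 * c2) * (Cmod w ^ k * (INR (N + 2 * k) + 1)))%R by ring.
    rewrite !(Rmult_assoc (B * / (c1 * c2))).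
    apply Rmult_le_compat_l; [apply Rmult_le_pos; lra|].
    apply H. split; [apply Cmod_ge_0 | exact Hw].
Qed.

Lemma cb_sum_correct (t q z w : C) (N : nat) :
  (Cmod q < 1)%R -> (Cmod t < 1)%R -> (Cmod z <= 1)%R -> (Cmod w < 1)%R ->
  Cser (cb_term t q z w N) (cb_sum t q z w N).
Proof.
  intros Hq Ht Hz Hw. apply CSeries_correct.
  destruct (cb_bound t q (Cmod w) Hq Ht (conj (Cmod_ge_0 w) Hw))
    as [D [r [HD [Hr H]]]].
  apply (Cser_ex _ (D * (INR N + 1)) r Hr). intros k.
  apply H; [exact Hz | lra | lia].
Qed.

Lemma cb_cert_cv_0 (t q z w : C) (N : nat) :
  (Cmod q < 1)%R -> (Cmod t < 1)%R -> (Cmod z <= 1)%R -> (Cmod w < 1)%R ->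
  Ccv (cb_cert t q z w N) 0.
Proof.
  intros Hq Ht Hz Hw.
  destruct (cb_bound t q (Cmod w) Hq Ht (conj (Cmod_ge_0 w) Hw))
    as [D [r [HD [Hr H]]]].
  assert (H1 : Ccv (fun k => w ^ k * rogers_szego q z (pred (N + 2 * k))
     / (fpoch q q k * fpoch (t * q) q (N + k))) 0).
  { apply (Ccv_0_geometric _ (D * (INR N + 1)) r Hr). intros k.
    apply H; [exact Hz | lra | lia]. }
  assert (H2 : Ccv (fun k => q ^ k) 0).
  { apply (Ccv_0_geometric _ 1 (Cmod q)).
    - split; [apply Cmod_ge_0 | exact Hq].
    - intros k. rewrite Cmod_pow. lra. }
  replace (RtoC 0) with
    (z * q ^ N * (1 + 0 - t - t * q ^ N * 0) * (1 - 0) * 0) by ring.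
  unfold cb_cert.
  apply (Ccv_ext (fun k => z * q ^ N * (1 + q ^ k - t - t * q ^ N * q ^ k)
    * (1 - q ^ k) * (w ^ k * rogers_szego q z (pred (N + 2 * k))
     / (fpoch q q k * fpoch (t * q) q (N + k))))).
  { intros k. rewrite (Cpow_add_r q). ring. }
  repeat first [exact H1 | exact H2 | apply Ccv_const
    | apply Ccv_mult | apply Ccv_minus | apply Ccv_plus].
Qed.

Lemma cb_sum_rec (t q z w : C) (N : nat) :
  (Cmod q < 1)%R -> (Cmod t < 1)%R -> (Cmod z <= 1)%R -> (Cmod w < 1)%R ->
  t = w * z ->
  (1 - t ^ 2 * q ^ N) * cb_sum t q z w (S N)
    = (1 - t * q ^ N) * (1 + z) * cb_sum t q z w N
      - (1 - q ^ N) * z * cb_sum t q z w (pred N).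
Proof.
  intros Hq Ht Hz Hw Et.
  pose proof (fun M => cb_sum_correct t q z w M Hq Ht Hz Hw) as HS.
  pose proof (Cser_minus _ _ _ _ (Cser_minus _ _ _ _
    (Cser_scal ((1 - t * q ^ N) * (1 + z)) _ _ (HS N))
    (Cser_scal ((1 - q ^ N) * z) _ _ (HS (pred N))))
    (Cser_scal (1 - t ^ 2 * q ^ N) _ _ (HS (S N)))) as H1.
  pose proof (Cser_telescope _ (cb_cert_cv_0 t q z w N Hq Ht Hz Hw)) as H2.
  pose proof (Ccv_unique _ _ _ H1 (Cser_ext _ _ _
    (fun k => eq_sym (cb_term_telescope t q z w N k Hq Ht Et)) H2)) as E.
  assert (E0 : cb_cert t q z w N 0 = 0).
  { unfold cb_cert. simpl (q ^ 0). ring. }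
  rewrite E0 in E.
  match type of E with ?a - ?b = _ =>
    transitivity (a - (a - b)); [ring | rewrite E; ring] end.
Qed.

Lemma cb_sum_rogers (t q z w : C) (N : nat) :
  (Cmod q < 1)%R -> (Cmod t < 1)%R -> (Cmod z <= 1)%R -> (Cmod w < 1)%R ->
  t = w * z ->
  cb_sum t q z w N = cb_sum t q z w 0 * rogers_ratio t q z N.
Proof.
  intros Hq Ht Hz Hw Et.
  assert (Ht2 : (Cmod (t ^ 2) < 1)%R).
  { simpl. rewrite Cmult_1_r. apply Cmod_mul_lt_1; lra. }
  (* A second-order recurrence needs two consecutive values in the induction; at [M = 0] both are
     the value at index 0. *)
  enough (H : forall M,
    cb_sum t q z w (pred M) = cb_sum t q z w 0 * rogers_ratio t q z (pred M)
    /\ cb_sum t q z w M = cb_sum t q z w 0 * rogers_ratio t q z M) by apply H.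
  induction M as [|M [IH1 IH2]].
  - assert (E : rogers_ratio t q z 0 = 1).
    { unfold rogers_ratio. rewrite rogers_0. unfold fpoch. simpl. field. }
    simpl pred. rewrite E. split; ring.
  - split; [exact IH2|].
    assert (D : 1 - t ^ 2 * q ^ M <> 0)
      by (apply one_minus_mul_pow_neq_0; assumption).
    transitivity ((1 - t ^ 2 * q ^ M) * cb_sum t q z w (S M)
      / (1 - t ^ 2 * q ^ M)); [field; exact D|].
    rewrite cb_sum_rec, IH1, IH2 by assumption.
    transitivity (cb_sum t q z w 0 *
      ((1 - t ^ 2 * q ^ M) * rogers_ratio t q z (S M)) / (1 - t ^ 2 * q ^ M)).
    + rewrite rogers_ratio_rec by assumption. field. exact D.
    + field. exact D.
Qed.

(** Termwise, [H_(N + 2k)] and [(t q; q)_(N + k)] tend to constants independent of [k]; what remains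
    to be summed is Euler's series in [w]. *)
Lemma cb_sum_cv (t q z w : C) :
  (Cmod q < 1)%R -> (Cmod t < 1)%R -> (Cmod z < 1)%R -> (Cmod w < 1)%R ->
  Ccv (cb_sum t q z w)
    (/ (qpoch_inf z q * qpoch_inf (t * q) q * qpoch_inf w q)).
Proof.
  intros Hq Ht Hz Hw.
  assert (Htq : (Cmod (t * q) < 1)%R) by (apply Cmod_mul_lt_1; lra).
  destruct (rogers_szego_bound_lt1 q z Hq Hz) as [B [HB0 HB]].
  destruct (fpoch_bounded_below q q Hq Hq) as [c1 [Hc1 H1]].
  destruct (fpoch_bounded_below (t * q) q Hq Htq) as [c2 [Hc2 H2]].
  pose proof (qpoch_inf_neq_0 q z Hq Hz) as N1.
  pose proof (qpoch_inf_neq_0 q (t * q) Hq Htq) as N2.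
  pose proof (qpoch_inf_neq_0 q w Hq Hw) as N3.
  replace (/ (qpoch_inf z q * qpoch_inf (t * q) q * qpoch_inf w q))
    with (/ (qpoch_inf z q * qpoch_inf (t * q) q) * / qpoch_inf w q)
    by (field; repeat split; assumption).
  apply (tannery (cb_term t q z w)
    (fun k => / (qpoch_inf z q * qpoch_inf (t * q) q) * (w ^ k / fpoch q q k))
    _ _ (B * / (c1 * c2)) (Cmod w)).
  - split; [apply Cmod_ge_0 | exact Hw].
  - intros N k. unfold cb_term.
    rewrite Cmod_div
      by (apply Cmult_neq_0; apply fpoch_neq_0; assumption).
    rewrite !Cmod_mult, Cmod_pow.
    replace (B * / (c1 * c2) * Cmod w ^ k)%R
      with (Cmod w ^ k * B * / (c1 * c2))%R by ring.
    apply Rmult_le_compat.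
    + apply Rmult_le_pos; [apply pow_le|]; apply Cmod_ge_0.
    + left. apply Rinv_0_lt_compat. specialize (H1 k). specialize (H2 (N + k)%nat).
      apply Rmult_lt_0_compat; lra.
    + apply Rmult_le_compat_l; [apply pow_le, Cmod_ge_0 | apply HB].
    + apply Rinv_le_contravar; [apply Rmult_lt_0_compat; assumption|].
      apply Rmult_le_compat; auto; lra.
  - intros k. pose proof (fpoch_neq_0 q q k Hq Hq) as N4.
    replace (/ (qpoch_inf z q * qpoch_inf (t * q) q) * (w ^ k / fpoch q q k))
      with (w ^ k * / qpoch_inf z q * / (fpoch q q k * qpoch_inf (t * q) q))
      by (field; repeat split; assumption).
    unfold cb_term, Cdiv. apply Ccv_mult.
    + apply Ccv_scal. apply (Ccv_subseq (rogers_szego q z)); [intros; lia|].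
      apply rogers_szego_cv; assumption.
    + apply Ccv_inv; [apply Cmult_neq_0; assumption|].
      apply Ccv_scal. apply (Ccv_subseq (fpoch (t * q) q)); [intros; lia|].
      apply fpoch_cv; assumption.
  - intros N. apply cb_sum_correct; try assumption. lra.
  - apply Cser_scal, euler_series; assumption.
Qed.

(** The closed form of [G_0], which is also the factor of [gamma] independent of [n]: [gamma] at [n]
    is [w ^ n] times this value times [rogers_ratio] at [2 * n]. *)
Definition cb_value (t q z w : C) : C :=
  qpoch_inf (t ^ 2) q
  / (qpoch_inf t q * qpoch_inf (t * q) q * qpoch_inf (t * z) q * qpoch_inf w q).

Lemma cb_sum_0_lt1 (t q z w : C) :
  (Cmod q < 1)%R -> (Cmod t < 1)%R -> (Cmod z < 1)%R -> (Cmod w < 1)%R ->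
  t = w * z -> cb_sum t q z w 0 = cb_value t q z w.
Proof.
  intros Hq Ht Hz Hw Et.
  assert (Ht2 : (Cmod (t ^ 2) < 1)%R).
  { simpl. rewrite Cmult_1_r. apply Cmod_mul_lt_1; lra. }
  assert (Htq : (Cmod (t * q) < 1)%R) by (apply Cmod_mul_lt_1; lra).
  assert (Htz : (Cmod (t * z) < 1)%R) by (apply Cmod_mul_lt_1; lra).
  pose proof (qpoch_inf_neq_0 q z Hq Hz) as N1.
  pose proof (qpoch_inf_neq_0 q (t * q) Hq Htq) as N2.
  pose proof (qpoch_inf_neq_0 q w Hq Hw) as N3.
  pose proof (qpoch_inf_neq_0 q (t * z) Hq Htz) as N4.
  pose proof (qpoch_inf_neq_0 q t Hq Ht) as N5.
  pose proof (qpoch_inf_neq_0 q (t ^ 2) Hq Ht2) as N6.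
  assert (E : / (qpoch_inf z q * qpoch_inf (t * q) q * qpoch_inf w q)
    = cb_sum t q z w 0 * (qpoch_inf t q * qpoch_inf (t * z) q
    / (qpoch_inf (t ^ 2) q * qpoch_inf z q))).
  { apply (Ccv_unique (cb_sum t q z w)); [apply cb_sum_cv; assumption|].
    apply (Ccv_ext (fun N => cb_sum t q z w 0 * rogers_ratio t q z N)).
    - intros N. symmetry. apply cb_sum_rogers; try assumption. lra.
    - apply Ccv_scal, rogers_ratio_cv; assumption. }
  unfold cb_value.
  transitivity (cb_sum t q z w 0 * (qpoch_inf t q * qpoch_inf (t * z) q
    / (qpoch_inf (t ^ 2) q * qpoch_inf z q))
    * (qpoch_inf (t ^ 2) q * qpoch_inf z q
       / (qpoch_inf t q * qpoch_inf (t * z) q))).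
  - field. repeat split; assumption.
  - rewrite <- E. field. repeat split; assumption.
Qed.

(** * Continuity and the unit circle *)

(** Stated for reciprocals because Euler's series represents [1 / (x; q)_oo], and dominated
    convergence applies to it on [|x| <= x0 < 1]. *)
Lemma qpoch_inf_cv (q : C) (u : nat -> C) (l : C) (x : R) :
  (Cmod q < 1)%R -> (x < 1)%R -> (forall n, (Cmod (u n) <= x)%R) -> Ccv u l ->
  Ccv (fun n => / qpoch_inf (u n) q) (/ qpoch_inf l q).
Proof.
  intros Hq Hx Hu Hl.
  assert (Hx0 : (0 <= x)%R).
  { specialize (Hu O). pose proof (Cmod_ge_0 (u O)). lra. }
  assert (Hlx : (Cmod l <= x)%R).
  { apply (Ccv_Cmod_le u); [exact Hl|]. exists O. intros n _. apply Hu. }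
  destruct (fpoch_bounded_below q q Hq Hq) as [c [Hc H]].
  apply (tannery (fun n j => u n ^ j / fpoch q q j)
    (fun j => l ^ j / fpoch q q j) _ _ (/ c) x).
  - lra.
  - intros n j. rewrite Cmod_div by (apply fpoch_neq_0; assumption).
    rewrite Cmod_pow, (Rmult_comm (/ c)).
    apply Rmult_le_compat.
    + apply pow_le, Cmod_ge_0.
    + left. apply Rinv_0_lt_compat. specialize (H j). lra.
    + apply pow_incr. split; [apply Cmod_ge_0 | apply Hu].
    + apply Rinv_le_contravar; auto.
  - intros j. apply Ccv_mult; [apply Ccv_pow; exact Hl | apply Ccv_const].
  - intros n. apply euler_series; [exact Hq|]. specialize (Hu n). lra.
  - apply euler_series; [exact Hq | lra].
Qed.

Lemma rogers_szego_continuous (q : C) (u : nat -> C) (l : C) (N : nat) :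
  Ccv u l -> Ccv (fun n => rogers_szego q (u n) N) (rogers_szego q l N).
Proof.
  intros Hu. apply Ccv_scal.
  apply (Ccv_Csum (fun n j => qcoef 0 q (N - j) * qcoef 0 q j * u n ^ j)).
  intros j. apply Ccv_scal. apply Ccv_pow, Hu.
Qed.

(* On the unit circle the limit [N -> oo] is not available, so [z] is approached
   along its radius. *)
Lemma cb_sum_0_eq1 (t q z w : C) :
  (Cmod q < 1)%R -> (Cmod t < 1)%R -> Cmod z = 1%R -> t = w * z ->
  cb_sum t q z w 0 = cb_value t q z w.
Proof.
  intros Hq Ht Hz Et.
  assert (Htq : (Cmod (t * q) < 1)%R) by (apply Cmod_mul_lt_1; lra).
  assert (Hwt : Cmod w = Cmod t).
  { rewrite Et, Cmod_mult, Hz. ring. }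
  assert (Hw : (Cmod w < 1)%R) by lra.
  pose proof (Cmod_ge_0 t) as Ht0.
  (* Radii increasing to 1 from [(1 + |t|) / 2]. Scaling [z] by [e n] and [w] by its inverse keeps
     the product equal to [t]. *)
  set (e := fun n : nat => (1 - (1 - Cmod t) / 2 * (/ 2) ^ n)%R).
  assert (He : forall n, ((1 + Cmod t) / 2 <= e n < 1)%R).
  { intros n. unfold e.
    assert (0 < (/ 2) ^ n)%R by (apply pow_lt; lra).
    assert ((/ 2) ^ n <= 1 ^ n)%R by (apply pow_incr; lra).
    rewrite pow1 in *. nra. }
  assert (Hec : Ccv (fun n => RtoC (e n)) 1).
  { assert (H : Ccv (fun n => RtoC (e n) - 1) 0).
    { apply (Ccv_0_geometric _ 1 (/ 2)); [lra|]. intros n.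
      rewrite <- RtoC_minus, Cmod_R. unfold e.
      assert (0 < (/ 2) ^ n)%R by (apply pow_lt; lra).
      rewrite Rabs_left1; nra. }
    replace (RtoC 1) with (0 + 1) by ring.
    apply (Ccv_ext (fun n => RtoC (e n) - 1 + 1)); [intros; ring|].
    apply Ccv_plus; [exact H | apply Ccv_const]. }
  assert (He0 : forall n, RtoC (e n) <> 0).
  { intros n H. apply (f_equal fst) in H. simpl in H. specialize (He n). lra. }
  set (zn := fun n => RtoC (e n) * z). set (wn := fun n => w * / RtoC (e n)).
  assert (Hzn : Ccv zn z).
  { replace z with (1 * z) at 1 by ring.
    apply Ccv_mult; [exact Hec | apply Ccv_const]. }
  assert (Hwn : Ccv wn w).
  { replace w with (w * / 1) at 1 by field.
    apply Ccv_scal, Ccv_inv; [|exact Hec].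
    intros H. apply (f_equal fst) in H. simpl in H. lra. }
  assert (Hzn1 : forall n, (Cmod (zn n) < 1)%R).
  { intros n. unfold zn. specialize (He n).
    rewrite Cmod_mult, Hz, Cmod_R, Rabs_pos_eq; lra. }
  (* This is [|t|] divided by the smallest radius: a bound below 1 for all [|wn n|], as the
     majorants demand. *)
  set (x := (2 * Cmod t / (1 + Cmod t))%R).
  assert (Hx : (0 <= x < 1)%R).
  { unfold x. split.
    - apply Rmult_le_pos; [lra|]. left. apply Rinv_0_lt_compat. lra.
    - apply Rmult_lt_reg_r with (1 + Cmod t)%R; [lra|].
      unfold Rdiv. rewrite Rmult_assoc, Rinv_l; lra. }
  assert (Hwnx : forall n, (Cmod (wn n) <= x)%R).
  { intros n. unfold wn. specialize (He n).
    rewrite Cmod_mult, Cmod_inv by apply He0.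
    rewrite Hwt, Cmod_R, Rabs_pos_eq by lra.
    replace x with (Cmod t * / ((1 + Cmod t) / 2))%R by (unfold x; field; lra).
    apply Rmult_le_compat_l; [exact Ht0|]. apply Rinv_le_contravar; lra. }
  assert (Etn : forall n, t = wn n * zn n).
  { intros n. unfold wn, zn. rewrite Et. field. apply He0. }
  apply (Ccv_unique (fun n => cb_sum t q (zn n) (wn n) 0)).
  - destruct (cb_bound t q x Hq Ht Hx) as [D [r [HD [Hr H]]]].
    apply (tannery (fun n k => cb_term t q (zn n) (wn n) 0 k)
      (fun k => cb_term t q z w 0 k) _ _ (D * (INR 0 + 1)) r Hr).
    + intros n k. apply H; [left; apply Hzn1 | apply Hwnx | lia].
    + intros k. unfold cb_term. apply Ccv_mult; [|apply Ccv_const].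
      apply Ccv_mult; [apply Ccv_pow; exact Hwn|].
      apply rogers_szego_continuous, Hzn.
    + intros n. apply cb_sum_correct; try assumption; [left; apply Hzn1|].
      specialize (Hwnx n). lra.
    + apply cb_sum_correct; try assumption. lra.
  - apply (Ccv_ext (fun n => qpoch_inf (t ^ 2) q
      / (qpoch_inf t q * qpoch_inf (t * q) q)
      * (/ qpoch_inf (t * zn n) q * / qpoch_inf (wn n) q))).
    + intros n. symmetry. specialize (Hwnx n).
      rewrite cb_sum_0_lt1; try assumption; [|apply Hzn1|lra|apply Etn].
      unfold cb_value. field.
      repeat split; apply qpoch_inf_neq_0; try assumption; try lra.
      apply Cmod_mul_lt_1; [assumption|]. left. apply Hzn1.
    + replace (cb_value t q z w) with (qpoch_inf (t ^ 2) q
      / (qpoch_inf t q * qpoch_inf (t * q) q)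
      * (/ qpoch_inf (t * z) q * / qpoch_inf w q)).
      2: { unfold cb_value. field.
        repeat split; apply qpoch_inf_neq_0; try assumption; try lra.
        apply Cmod_mul_lt_1; lra. }
      apply Ccv_scal, Ccv_mult.
      * apply (qpoch_inf_cv q (fun n => t * zn n) _ (Cmod t) Hq Ht);
          [|apply Ccv_scal, Hzn].
        intros n. rewrite Cmod_mult. specialize (Hzn1 n). nra.
      * apply (qpoch_inf_cv q wn _ x Hq); [lra | exact Hwnx | exact Hwn].
Qed.

(** * Conjugate Bailey pair *)

Lemma Cpowz_sub (z : C) (j n : nat) : z <> 0 ->
  Cpowz z (Z.of_nat j - Z.of_nat n) = z ^ j / z ^ n.
Proof.
  intros Hz. pose proof (Cpow_nz z n Hz) as Hn. pose proof (Cpow_nz z j Hz) as Hj.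
  destruct (Z.of_nat j - Z.of_nat n)%Z as [|p|p] eqn:E; simpl.
  - replace j with n by lia. field. exact Hn.
  - replace j with (Pos.to_nat p + n)%nat by lia.
    rewrite Cpow_add_r. field. exact Hn.
  - replace n with (Pos.to_nat p + j)%nat by lia.
    rewrite Cpow_add_r. field. split; [exact Hj | apply Cpow_nz, Hz].
Qed.

Lemma Cinv_neq_0 (z : C) : z <> 0 -> / z <> 0.
Proof.
  intros Hz. apply Cmod_gt_0. rewrite Cmod_inv by exact Hz.
  apply Rinv_0_lt_compat, Cmod_gt_0, Hz.
Qed.

(** The coefficients are symmetric under [j -> N - j]; this is the source of the invariance of
    [delta] and [gamma] under [z -> 1 / z]. *)
Lemma rogers_inv (t q z : C) (N : nat) : z <> 0 ->
  rogers t q (/ z) N = rogers t q z N / z ^ N.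
Proof.
  intros Hz. unfold rogers, Cdiv.
  rewrite Csum_rev, Cmult_comm, <- Csum_scal. apply Csum_ext. intros k Hk.
  replace (N - (N - k))%nat with k by lia.
  rewrite Cpow_inv by exact Hz.
  replace (z ^ N) with (z ^ (N - k) * z ^ k)
    by (rewrite <- Cpow_add_r; f_equal; lia).
  field. split; apply Cpow_nz, Hz.
Qed.

Lemma delta_rogers_szego (q t z : C) (l : nat) : (Cmod q < 1)%R -> z <> 0 ->
  delta q t z l = (t * / z) ^ l * rogers_szego q z (2 * l).
Proof.
  intros Hq Hz. unfold delta, rogers_szego, rogers.
  pose proof (Cpow_nz z l Hz) as Hl.
  rewrite Csum_sum_n, Cpow_mult_l, Cpow_inv by exact Hz.
  transitivity (t ^ l * (/ z ^ l * fpoch q q (2 * l)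
    * Csum (fun j => qcoef 0 q (2 * l - j) * qcoef 0 q j * z ^ j) (S (2 * l))));
    [|ring].
  f_equal. rewrite <- Csum_scal. apply Csum_ext. intros j Hj.
  unfold qbinom. rewrite (proj2 (Nat.leb_le j (2 * l))) by lia.
  rewrite !qpoch_fpoch, Cpowz_sub by assumption.
  unfold qcoef. rewrite !fpoch_0. field.
  repeat split; try assumption; apply fpoch_neq_0; assumption.
Qed.

Lemma gamma_rogers (q t z : C) (n : nat) :
  (Cmod q < 1)%R -> (Cmod t < 1)%R -> z <> 0 ->
  gamma q t z n = t ^ n * fpoch q q (2 * n) * qpoch_inf (t ^ 2) q
    / (fpoch (t ^ 2) q (2 * n) * (qpoch_inf t q * qpoch_inf (t * q) q *
        qpoch_inf (t * z) q * qpoch_inf (t * / z) q))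
    * (rogers t q z (2 * n) / z ^ n).
Proof.
  intros Hq Ht Hz. pose proof (Cpow_nz z n Hz) as Hn.
  assert (Ht2 : (Cmod (t ^ 2) < 1)%R).
  { simpl. rewrite Cmult_1_r. apply Cmod_mul_lt_1; lra. }
  unfold gamma, rogers. rewrite !qpoch_fpoch, Csum_sum_n by assumption.
  f_equal.
  match goal with |- _ = ?a / ?b => change (a / b) with (a * / b) end.
  rewrite Cmult_comm, <- Csum_scal.
  apply Csum_ext. intros j Hj.
  rewrite !qpoch_fpoch, Cpowz_sub by assumption.
  unfold qcoef. field.
  repeat split; try assumption; apply fpoch_neq_0; assumption.
Qed.

Lemma delta_inv (q t z : C) (l : nat) : (Cmod q < 1)%R -> z <> 0 ->
  delta q t (/ z) l = delta q t z l.
Proof.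
  intros Hq Hz.
  assert (Hz' : / z <> 0) by (apply Cinv_neq_0, Hz).
  rewrite !delta_rogers_szego by assumption. unfold rogers_szego.
  rewrite rogers_inv by exact Hz.
  rewrite !Cpow_mult_l, !Cpow_inv by assumption.
  replace (z ^ (2 * l)) with (z ^ l * z ^ l)
    by (rewrite <- Cpow_add_r; f_equal; lia).
  field. apply Cpow_nz, Hz.
Qed.

Lemma gamma_inv (q t z : C) (n : nat) :
  (Cmod q < 1)%R -> (Cmod t < 1)%R -> z <> 0 ->
  gamma q t (/ z) n = gamma q t z n.
Proof.
  intros Hq Ht Hz.
  assert (Hz' : / z <> 0) by (apply Cinv_neq_0, Hz).
  rewrite !gamma_rogers by assumption.
  replace (/ / z) with z by (field; exact Hz).
  rewrite rogers_inv, Cpow_inv by exact Hz.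
  f_equal.
  - f_equal. f_equal. ring.
  - replace (z ^ (2 * n)) with (z ^ n * z ^ n)
      by (rewrite <- Cpow_add_r; f_equal; lia).
    field. apply Cpow_nz, Hz.
Qed.

(** With [l = n + k], the indices [2 l] and [l + n] become [N + 2k] and [N + k] for [N = 2n], and
    [w ^ n] factors out of [w ^ l]. *)
Lemma cbp_term_cb_term (q t z : C) (n k : nat) :
  (Cmod q < 1)%R -> (Cmod t < 1)%R -> z <> 0 ->
  cbp_term t q (delta q t z) n (n + k)
    = (t * / z) ^ n * cb_term t q z (t * / z) (2 * n) k.
Proof.
  intros Hq Ht Hz.
  assert (Htq : (Cmod (t * q) < 1)%R) by (apply Cmod_mul_lt_1; lra).
  unfold cbp_term, cb_term. rewrite delta_rogers_szego by assumption.
  rewrite !qpoch_fpoch by assumption.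
  replace (n + k - n)%nat with k by lia.
  replace (n + k + n)%nat with (2 * n + k)%nat by lia.
  replace (2 * (n + k))%nat with (2 * n + 2 * k)%nat by lia.
  rewrite (Cpow_add_r (t * / z)). field.
  split; apply fpoch_neq_0; assumption.
Qed.

(* The terms are [w ^ k] times a sequence with a nonzero limit. *)
Lemma cb_term_cv_0_inv (t q z w : C) :
  (Cmod q < 1)%R -> (Cmod t < 1)%R -> (Cmod z < 1)%R ->
  Ccv (cb_term t q z w 0) 0 -> (Cmod w < 1)%R.
Proof.
  intros Hq Ht Hz H. apply Rnot_le_lt. intros Hw.
  assert (Htq : (Cmod (t * q) < 1)%R) by (apply Cmod_mul_lt_1; lra).
  set (u := fun k => rogers_szego q z (2 * k) / (fpoch q q k * fpoch (t * q) q k)).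
  pose proof (qpoch_inf_neq_0 q z Hq Hz) as N1.
  pose proof (qpoch_inf_neq_0 q q Hq Hq) as N2.
  pose proof (qpoch_inf_neq_0 q (t * q) Hq Htq) as N3.
  set (U := / qpoch_inf z q * / (qpoch_inf q q * qpoch_inf (t * q) q)).
  assert (Hu : Ccv u U).
  { apply Ccv_mult.
    - apply (Ccv_subseq (rogers_szego q z)); [intros; lia|].
      apply rogers_szego_cv; assumption.
    - apply Ccv_inv; [apply Cmult_neq_0; assumption|].
      apply Ccv_mult; apply fpoch_cv; assumption. }
  assert (Hu0 : Ccv u 0).
  { intros eps Heps. destruct (H eps Heps) as [N HN].
    exists N. intros n Hn. specialize (HN n Hn).
    eapply Rle_lt_trans; [|exact HN].
    replace (cb_term t q z w 0 n - 0) with (w ^ n * u n)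
      by (unfold cb_term, u, Cdiv; rewrite !Nat.add_0_l; ring).
    replace (u n - 0) with (u n) by ring.
    rewrite Cmod_mult, Cmod_pow.
    pose proof (pow_R1_Rle (Cmod w) n Hw). pose proof (Cmod_ge_0 (u n)). nra. }
  pose proof (Ccv_unique _ _ _ Hu Hu0) as E.
  assert (E1 : RtoC 1 = 0).
  { transitivity (U * (qpoch_inf z q * (qpoch_inf q q * qpoch_inf (t * q) q))).
    - unfold U. field. repeat split; assumption.
    - rewrite E. ring. }
  apply (f_equal fst) in E1. simpl in E1. lra.
Qed.

(** For [|z| < 1], convergence at [n = 0] forces [|w| < 1]; for [|z| = 1] this follows from
    [|w| = |t|]. Once [|w| < 1] is known, the geometric majorants give convergence for every [n]. *)
Lemma conjugate_bailey_pair_le1 (q t z : C) :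
  (Cmod q < 1)%R -> (Cmod t < 1)%R -> z <> 0 -> (Cmod z <= 1)%R ->
  ex_series (fun k : nat => cbp_term t q (delta q t z) 0 (0 + k)%nat) ->
  conjugate_bailey_pair t q (gamma q t z) (delta q t z).
Proof.
  intros Hq Ht Hz Hz1 [l Hl] n.
  assert (Ht2 : (Cmod (t ^ 2) < 1)%R).
  { simpl. rewrite Cmult_1_r. apply Cmod_mul_lt_1; lra. }
  assert (Htq : (Cmod (t * q) < 1)%R) by (apply Cmod_mul_lt_1; lra).
  assert (Htz : (Cmod (t * z) < 1)%R) by (apply Cmod_mul_lt_1; lra).
  set (w := t * / z).
  assert (Et : t = w * z) by (unfold w; field; exact Hz).
  assert (Hw : (Cmod w < 1)%R /\ cb_sum t q z w 0 = cb_value t q z w).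
  { destruct (Rle_lt_or_eq_dec _ _ Hz1) as [Hlt|Heq].
    - assert (Hw : (Cmod w < 1)%R).
      { apply (cb_term_cv_0_inv t q z w Hq Ht Hlt).
        apply Cser_is_series, Cser_terms_0 in Hl.
        refine (Ccv_ext _ _ _ _ Hl). intros k.
        rewrite cbp_term_cb_term by assumption. fold w. simpl. ring. }
      split; [exact Hw|]. apply cb_sum_0_lt1; assumption.
    - split; [|apply cb_sum_0_eq1; assumption].
      rewrite Et, Cmod_mult, Heq in Ht. lra. }
  destruct Hw as [Hw E0].
  apply Cser_is_series.
  apply (Cser_ext (fun k => w ^ n * cb_term t q z w (2 * n) k)).
  { intros k. symmetry. apply cbp_term_cb_term; assumption. }
  replace (gamma q t z n) with (w ^ n * cb_sum t q z w (2 * n)).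
  { apply Cser_scal, cb_sum_correct; assumption. }
  rewrite cb_sum_rogers, E0 by assumption. rewrite gamma_rogers by assumption.
  fold w. unfold cb_value, rogers_ratio. unfold w at 1.
  rewrite Cpow_mult_l, Cpow_inv by exact Hz.
  field. repeat split; try apply qpoch_inf_neq_0; try apply fpoch_neq_0;
    try apply Cpow_nz; assumption.
Qed.

Theorem theorem3p1 (q t z : C)
  (hq : (Cmod q < 1)%R) (ht : (Cmod t < 1)%R) (hz : z <> 0)
  (htz : qpoch_inf (t * z) q <> 0) (htz' : qpoch_inf (t * / z) q <> 0)
  (hconv : forall n : nat,
     ex_series (fun k : nat => cbp_term t q (delta q t z) n (n + k)%nat)) :
  conjugate_bailey_pair t q (gamma q t z) (delta q t z).
Proof.
  destruct (Rle_lt_dec (Cmod z) 1) as [Hz1|Hz1].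
  - apply conjugate_bailey_pair_le1; auto.
  - assert (Hz' : / z <> 0) by (apply Cinv_neq_0, hz).
    assert (Hd : forall n l, cbp_term t q (delta q t (/ z)) n l
        = cbp_term t q (delta q t z) n l).
    { intros n l. unfold cbp_term. rewrite delta_inv by assumption. reflexivity. }
    assert (H : conjugate_bailey_pair t q (gamma q t (/ z)) (delta q t (/ z))).
    { apply conjugate_bailey_pair_le1; try assumption.
      - rewrite Cmod_inv by exact hz. rewrite <- Rinv_1.
        apply Rinv_le_contravar; lra.
      - refine (ex_series_ext _ _ _ (hconv O)).
        intros k. symmetry. apply Hd. }
    intros n. rewrite <- gamma_inv by assumption.
    refine (is_series_ext _ _ _ _ (H n)). intros k. apply Hd.
Qed.
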